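(* Let $V_1,\ldots,V_m$ be finite, pairwise disjoint sets, regarded as $0$-dimensional simplicial complexes, and let $V_1*\cdots*V_m$ denote their join. Let $\Delta_{m-1}$ be the simplex on the vertex set $[m]=\{1,\ldots,m\}$ and let $\pi: V_1*\cdots*V_m\to\Delta_{m-1}$ be the simplicial map given by $\pi(v)=i$ for $v\in V_i$. Let $X\subset V_1*\cdots*V_m$ be a subcomplex, let $Y=\pi(X)$, and let $r=r(X,\pi)=\max\{|\pi^{-1}(\pi(x))|: x\in|X|\}$. Then $$L(Y)\le r\,L(X)+r-1.$$
   Context: The join $V_1*\cdots*V_m$ is the simplicial complex on the vertex set $V_1\cup\cdots\cup V_m$ whose simplices are the subsets containing at most one vertex from each $V_i$. The map $\pi$ is extended linearly to geometric realizations, and in $r(X,\pi)$ the preimage $\pi^{-1}(\pi(x))$ is taken inside $|X|$; $Y=\pi(X)=\{\pi(\sigma):\sigma\in X\}$ is a subcomplex of $\Delta_{m-1}$. For a simplicial complex $K$ on vertex set $W$ and $S\subset W$, the induced subcomplex is $K[S]=\{\sigma\in K:\sigma\subset S\}$. The rational Leray number $L(K)$ is the minimal integer $d$ such that $\tilde{\mathrm H}_i(Z;\mathbb Q)=0$ for every induced subcomplex $Z$ of $K$ and every $i\ge d$. *)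

(* Defs.v *)
From HB Require Import structures.
From mathcomp Require Import all_boot all_order all_algebra.
From mathcomp Require Import Rstruct.
From Stdlib Require Rdefinitions.
Set Implicit Arguments. Unset Strict Implicit. Unset Printing Implicit Defensive.
Import Order.TTheory GRing.Theory Num.Theory.
Local Open Scope ring_scope.

(* A simplicial complex on the finite vertex set T: a down-closed family of
   finite subsets of T (the void complex and {emptyset} are allowed). *)
Definition is_complex (T : finType) (K : {set {set T}}) : Prop :=
  forall s t : {set T}, s \in K -> t \subset s -> t \in K.

Definition induced (T : finType) (K : {set {set T}}) (S : {set T}) : {set {set T}} :=
  [set s in K | s \subset S].

Definition nsets (T : finType) : nat := #|{: {set T}}|.
Definition sidx (T : finType) (a : 'I_(nsets T)) : {set T} := enum_val a.

(* Oriented simplicial boundary, vertices ordered by enum_rank: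
   d(v_0 ... v_i) = \sum_j (-1)^j (v_0 .. ^v_j .. v_i).
   Coefficient of tau in the boundary of the i-simplex sigma of K
   (sigma has i+1 vertices).  For i = 0 this is the augmentation
   (coefficient 1 on the empty simplex), giving reduced homology. *)
Definition bdry_coef (T : finType) (K : {set {set T}}) (i : nat)
    (sigma tau : {set T}) : rat :=
  if (sigma \in K) && (#|sigma| == i.+1) then
    \sum_(v in sigma | tau == sigma :\ v)
       (-1) ^+ #|[set u in sigma | (nat_of_ord (enum_rank u) < nat_of_ord (enum_rank v))%N]|
  else 0.

(* Matrix of the boundary map C_i -> C_{i-1} (row-vector convention);
   rows/columns indexed by all subsets of T, rows outside C_i are zero. *)
Definition bdry_mx (T : finType) (K : {set {set T}}) (i : nat)
    : 'M[rat]_(nsets T) :=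
  \matrix_(a, b) bdry_coef K i (sidx a) (sidx b).

(* Projection onto the chain group C_i (span of the i-simplices of K). *)
Definition chain_mx (T : finType) (K : {set {set T}}) (i : nat)
    : 'M[rat]_(nsets T) :=
  diag_mx (\row_a (if (sidx a \in K) && (#|sidx a| == i.+1) then 1 else 0)).

(* reduced rational homology in degree i vanishes:
   every i-cycle is an i-boundary, i.e. Z_i <= B_i. *)
Definition rhom_vanish (T : finType) (K : {set {set T}}) (i : nat) : Prop :=
  ((kermx (bdry_mx K i) :&: chain_mx K i) <= bdry_mx K i.+1)%MS.

Definition leray_bound (T : finType) (K : {set {set T}}) (d : nat) : Prop :=
  forall (S : {set T}) (i : nat), (d <= i)%N -> rhom_vanish (induced K S) i.

Definition is_leray_number (T : finType) (K : {set {set T}}) (L : nat) : Prop :=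
  leray_bound K L /\ forall d, leray_bound K d -> (L <= d)%N.

(* The vertex set is a finite type W, partitioned into V_i = c^-1(i), i in 'I_m;
   pi(v) = c v.  A subcomplex of the join = a complex all of whose simplices
   contain at most one vertex of each V_i. *)
Definition colorful (W : finType) (m : nat) (c : W -> 'I_m) (s : {set W}) : Prop :=
  forall u v, u \in s -> v \in s -> c u = c v -> u = v.

Definition image_complex (W : finType) (m : nat) (c : W -> 'I_m)
    (X : {set {set W}}) : {set {set 'I_m}} :=
  [set c @: (s : {set W}) | s : {set W} in X].

(* A point of |K|: a barycentric-coordinate vector x : W -> R, x >= 0,
   summing to 1, whose support is a simplex of K. *)
Definition in_realization (W : finType) (X : {set {set W}}) (x : {ffun W -> Rdefinitions.R}) : Prop :=
  (forall v, 0 <= x v) /\ \sum_v x v = 1 /\ [set v | x v != 0] \in X.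

(* linear extension of pi to |X| -> |Delta_{m-1}| *)
Definition pi_real (W : finType) (m : nat) (c : W -> 'I_m) (x : {ffun W -> Rdefinitions.R})
    : {ffun 'I_m -> Rdefinitions.R} :=
  [ffun i => \sum_(v | c v == i) x v].

Definition fiber (W : finType) (m : nat) (c : W -> 'I_m) (X : {set {set W}})
    (x : {ffun W -> Rdefinitions.R}) (y : {ffun W -> Rdefinitions.R}) : Prop :=
  in_realization X y /\ pi_real c y = pi_real c x.

Definition is_r (W : finType) (m : nat) (c : W -> 'I_m) (X : {set {set W}}) (r : nat) : Prop :=
  (exists x, in_realization X x /\
     exists s : seq {ffun W -> Rdefinitions.R}, [/\ uniq s, size s = r &
        forall y, fiber c X x y <-> y \in s]) /\
  (forall x, in_realization X x ->
     forall s : seq {ffun W -> Rdefinitions.R}, uniq s -> (forall y, y \in s -> fiber c X x y) ->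
       (size s <= r)%N).

(* Main.v *)
(* Let A(q) be the rational vector space on the simplices of X with image q, for
   q a set of colours. Deleting colours makes A a functor on subsets of [m], with
   chain complex that of X, and X[pi^-1 T] corresponds to restricting A to the
   subsets of T; call A L-Leray when the homology of all these restrictions
   vanishes in the sizes |q| > L.

   If A is a-Leray and B is b-Leray then their pointwise product A(q) (x) B(q)
   is (a+b)-Leray. Indeed A embeds in the direct sum F, over the s with
   |s| <= a, of the functors q |-> A(s) supported on the q containing s;
   F (x) B has no homology in sizes > a+b because its summands compute
   homology of links in B, and F/A is (a+1)-Leray, so a descending induction
   on the size applies. Hence the k-th tensor power of A is kL-Leray, and so is
   its direct summand, the k-th exterior power.

   Since A(q) is the space with basis the lifts of q, of which there are
   between 1 and r when q is in Y, the exterior powers of A(q) form an exact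
   complex 0 <- Q <- A(q) <- ... <- Lambda^r A(q) <- 0. Chasing a cycle of Y through
   the double complex bounds it as soon as its size exceeds rL + r - 1. *)
Require Import Defs.
From HB Require Import structures.
From mathcomp Require Import all_boot all_order all_fingroup all_algebra.
From mathcomp Require Import Rstruct ring.
Set Implicit Arguments. Unset Strict Implicit. Unset Printing Implicit Defensive.
Import Order.TTheory GRing.Theory Num.Theory.
Local Open Scope ring_scope.

(** * Chains with a boundary indexed by the subsets of a finite set *)

(* Koszul sign; with the vertex order of [bdry_coef] it is the sign of the
   face [q] in the boundary of [i |: q], and it ignores whether [i] is in [q]. *)
Definition sg (I : finType) (i : I) (q : {set I}) : rat :=
  (-1) ^+ #|[set j in q | (enum_rank j < enum_rank i)%N]|.

Section Sign.
Variable I : finType.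
Implicit Types (i j : I) (q : {set I}).

Lemma sgU i j q : j \notin q ->
  sg i (j |: q) = (if (enum_rank j < enum_rank i)%N then -1 else 1) * sg i q.
Proof.
move=> jq; rewrite /sg; case: ifP => ij.
  rewrite -exprS; congr (_ ^+ _).
  have -> : [set k in j |: q | (enum_rank k < enum_rank i)%N]
          = j |: [set k in q | (enum_rank k < enum_rank i)%N].
    by apply/setP => k; rewrite !inE; case: eqP => // ->; rewrite ij.
  by rewrite cardsU1 inE (negPf jq).
rewrite mul1r; congr (_ ^+ #|pred_of_set _|); apply/setP => k; rewrite !inE.
by case: eqP => // ->; rewrite ij (negPf jq).
Qed.

Lemma sg_sq i q : sg i q * sg i q = 1.
Proof. by rewrite /sg -exprD addnn -mul2n exprM sqrrN !expr1n. Qed.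

Lemma sgUid i q : sg i (i |: q) = sg i q.
Proof.
have [iq|iq] := boolP (i \in q); last by rewrite sgU // ltnn mul1r.
by congr sg; apply/setUidPr; rewrite sub1set.
Qed.

Lemma sg_anti i j q : i != j -> i \notin q -> j \notin q ->
  sg i q * sg j (i |: q) = - (sg j q * sg i (j |: q)).
Proof.
move=> ij iq jq; rewrite !sgU //.
have : (enum_rank i != enum_rank j :> nat) by rewrite (inj_eq val_inj) (inj_eq enum_rank_inj).
by case: ltngtP => // _ _; rewrite ?mulN1r ?mul1r ?mulrN ?opprK // mulrC.
Qed.
End Sign.

Section Chains.
Variables (I : finType) (V : lmodType rat).
Implicit Types (z w : {ffun {set I} -> V}) (q T : {set I}) (n : nat).
Implicit Types (M N : {set I} -> V -> Prop) (u : I -> {linear V -> V}).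

(** A chain is a function on all subsets of [I] with values in one ambient space; [u i] plays the
    role of the map from the value at [i |: q] to the value at [q]. Subspaces and quotients are
    imposed afterwards, as predicates. *)
Definition bd u z := [ffun q : {set I} => \sum_(i | i \notin q) sg i q *: u i (z (i |: q))].

Lemma bdE u z q : bd u z q = \sum_(i | i \notin q) sg i q *: u i (z (i |: q)).
Proof. by rewrite ffunE. Qed.

Fact bd_is_linear u : linear (bd u).
Proof.
move=> a z w; apply/ffunP => q; rewrite !ffunE scaler_sumr -big_split.
by apply: eq_bigr => i _; rewrite !ffunE linearP scalerDr !scalerA mulrC.
Qed.
HB.instance Definition _ u := GRing.isLinear.Build rat _ _ _ (bd u) (bd_is_linear u).

Lemma chainB z w q : (z - w) q = z q - w q. Proof. by rewrite !ffunE. Qed.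
Lemma bd0 u : bd u 0 = 0. Proof. exact: linear0. Qed.
Lemma bdB u z w : bd u (z - w) = bd u z - bd u w. Proof. exact: linearB. Qed.

Lemma bd_sum u (J : finType) (F : J -> {ffun {set I} -> V}) :
  bd u (\sum_j F j) = \sum_j bd u (F j).
Proof. exact: linear_sum. Qed.

Lemma opp_self0 (x : V) : x = - x -> x = 0.
Proof.
move=> xN; have : x *+ 2 == 0 by rewrite mulr2n {1}xN addNr.
by rewrite -scaler_nat scaler_eq0 pnatr_eq0 => /eqP.
Qed.

(** The double sum over ordered pairs of distinct [i] and [j] outside [q] is antisymmetric by
    [sg_anti], so it equals its own opposite. *)
Lemma bd_bd u z : (forall i j v, u i (u j v) = u j (u i v)) -> bd u (bd u z) = 0.
Proof.
move=> uC; apply/ffunP => q; rewrite bdE ffunE; apply: opp_self0.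
have -> : \sum_(i | i \notin q) sg i q *: u i (bd u z (i |: q)) =
    \sum_(i | i \notin q) \sum_(j | (j \notin q) && (i != j))
      (sg i q * sg j (i |: q)) *: u i (u j (z (j |: (i |: q)))).
  apply: eq_bigr => i iq; rewrite bdE linear_sum scaler_sumr.
  apply: eq_big => [j|j _]; last by rewrite linearZ scalerA.
  by rewrite !inE negb_or eq_sym andbC.
rewrite {1}(exchange_big_dep (fun j => j \notin q)) /=; last by move=> ? ? _ /andP[].
rewrite -sumrN; apply: eq_bigr => j jq; rewrite -sumrN.
apply: eq_big => [i|i /andP[iq /andP[_ ij]]]; first by rewrite jq eq_sym.
by rewrite sg_anti // scaleNr uC !setUA [[set i] :|: _]setUC.
Qed.

Definition supp T n z := forall q, ~~ ((q \subset T) && (#|q| == n)) -> z q = 0.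

(* Exactness, at the sets [q] of size [n] contained in [T], of the chain complex
   with terms [M q / N q]; the quotient is never formed. *)
Definition exact u M N T n := forall z, supp T n z -> (forall q, M q (z q)) ->
  (forall q, N q (bd u z q)) ->
  exists w, [/\ supp T n.+1 w, forall q, M q (w q) & forall q, N q (z q - bd u w q)].

Definition is_zero (q : {set I}) (v : V) := v = 0.

Lemma supp_bd u T n z : supp T n.+1 z -> supp T n (bd u z).
Proof.
move=> zT q qT; rewrite bdE big1 // => i iq.
rewrite zT ?linear0 ?scaler0 //; apply: contra qT.
by rewrite cardsU1 iq add1n eqSS subUset -andbA => /and3P[_ -> ->].
Qed.

Definition submodP (P : V -> Prop) := P 0 /\ forall a x y, P x -> P y -> P (a *: x + y).

Lemma supp_sub T n z w : supp T n z -> supp T n w -> supp T n (z - w).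
Proof. by move=> zT wT q qT; rewrite chainB zT ?wT // subrr. Qed.

Lemma submodP_sum (P : V -> Prop) (J : finType) (A : pred J) (F : J -> V) :
  submodP P -> (forall i, A i -> P (F i)) -> P (\sum_(i | A i) F i).
Proof.
move=> [P0 PD] PF; elim/big_ind: _ => // x y Px Py.
by rewrite -[x]scale1r; apply: PD.
Qed.

Lemma submodPZ (P : V -> Prop) a x : submodP P -> P x -> P (a *: x).
Proof. by move=> [P0 PD] Px; rewrite -[_ *: _]addr0; apply: PD. Qed.

Lemma submodPB (P : V -> Prop) x y : submodP P -> P x -> P y -> P (x - y).
Proof. by move=> [P0 PD] Px Py; rewrite addrC -scaleN1r; apply: PD. Qed.

Lemma bd_in u M z : (forall q, submodP (M q)) ->
  (forall i q v, i \notin q -> M (i |: q) v -> M q (u i v)) ->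
  (forall q, M q (z q)) -> forall q, M q (bd u z q).
Proof.
move=> Ms Mu Mz q; rewrite bdE; apply: submodP_sum => // i iq.
by apply: submodPZ => //; apply: Mu.
Qed.

(* The truncated complex on the [q] containing [s] computes the link of [s].
   To add a vertex [x] to [s]: the boundary of [z] in the complex of [s :\ x] lives
   on the [q] avoiding [x], so by induction it bounds some [w] there, and
   [z - w] is then a cycle which bounds by induction as well. *)
Lemma exact_link u M L : (forall i j v, u i (u j v) = u j (u i v)) ->
  (forall q, submodP (M q)) ->
  (forall i q v, i \notin q -> M (i |: q) v -> M q (u i v)) ->
  (forall T n, (L < n)%N -> exact u M is_zero T n) ->
  forall (s T : {set I}) n, (L + #|s| < n)%N ->
  forall z, supp T n z -> (forall q, M q (z q)) ->
    (forall q, ~~ (s \subset q) -> z q = 0) ->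
    (forall q, s \subset q -> bd u z q = 0) ->
  exists w, [/\ supp T n.+1 w, forall q, M q (w q),
     forall q, ~~ (s \subset q) -> w q = 0 & forall q, s \subset q -> z q = bd u w q].
Proof.
move=> uC Ms Mu ex s; move: {2}#|s| (erefl #|s|) => k.
elim: k s => [|k IHk] s sk T n Ln z zT Mz zs dz.
  have s0 q : s \subset q by move/eqP: sk; rewrite cards_eq0 => /eqP->; rewrite sub0set.
  have [||w [wT Mw zw]] := ex T n _ z zT Mz; first by rewrite sk addn0 in Ln.
    by move=> q; apply: dz.
  exists w; split => // q; first by rewrite s0.
  by move=> _; apply/subr0_eq/zw.
have [x xs] : exists x, x \in s by apply/card_gt0P; rewrite sk.
pose t := s :\ x; have tk : #|t| = k by move: sk; rewrite (cardsD1 x) xs => -[].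
have st q : (s \subset q) = (x \in q) && (t \subset q).
  by rewrite -(setD1K xs) subUset sub1set -/t.
have Ltn : (L + #|t| < n)%N by rewrite tk; move: Ln; rewrite sk addnS => /ltnW.
case: n => [//|n] in Ln zT Ltn *.
pose y := [ffun q : {set I} => if t \subset q then bd u z q else 0].
have My q : M q (y q) by rewrite ffunE; case: ifP => _; [exact: bd_in|case: (Ms q)].
have y0 q : x \in q -> y q = 0.
  by move=> xq; rewrite ffunE; case: ifP => // tq; rewrite dz // st xq.
have yT : supp (T :\ x) n y.
  move=> q qT; have [/y0 //|xq] := boolP (x \in q).
  rewrite ffunE; case: ifP => // _; apply: (supp_bd u zT); apply: contra qT.
  by case/andP=> qT ->; rewrite subsetD1 qT xq.
have dy q : t \subset q -> bd u y q = 0.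
  move=> tq; have /ffunP/(_ q) := bd_bd z uC; rewrite [RHS]ffunE => <-; rewrite !bdE.
  apply: eq_bigr => i iq; congr (_ *: u i _).
  by rewrite ffunE (subset_trans tq (subsetUr _ _)).
have [||w [wT Mw wt yw]] := IHk t tk (T :\ x) n _ y yT My _ dy.
- by move: Ln; rewrite sk tk addnS.
- by move=> q /negPf tq; rewrite ffunE tq.
have wT' : supp T n.+1 w.
  move=> q qT; apply: wT; apply: contra qT.
  by rewrite subsetD1 -andbA => /and3P[-> _ ->].
have [|||||v [vT Mv vt zv]] := IHk t tk T n.+1 _ (z - w).
- by [].
- exact: supp_sub.
- by move=> q; rewrite !ffunE; apply: submodPB.
- by move=> q tq; rewrite !ffunE zs ?wt ?subrr // st negb_and tq orbT.
- move=> q tq; have yq : y q = bd u z q by rewrite ffunE tq.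
  by transitivity (bd u z q - bd u w q); [rewrite linearB !ffunE | rewrite -yq yw // subrr].
(* [w] vanishes on the sets containing [x], so [z] agrees with the boundary of [v] there; only the
   values of [v] on larger sets, which also contain [x], enter. *)
pose v' := [ffun q : {set I} => if x \in q then v q else 0].
exists v'; split.
- by move=> q qT; rewrite ffunE vT //; case: ifP.
- by move=> q; rewrite ffunE; case: ifP => // _; case: (Ms q).
- by move=> q; rewrite st negb_and ffunE; case: ifP => //= _ /vt.
move=> q; rewrite st => /andP[xq tq].
have := zv q tq; rewrite !ffunE wT ?subr0; last by rewrite subsetD1 xq andbF.
move=> ->; apply: eq_bigr => i iq.
by rewrite ffunE inE xq orbT.
Qed.

End Chains.

(** * Coordinate projections and coordinate subspaces *)

Section Mask.
Variables (J : finType) (Z : vectType rat).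

Definition maskf (P : pred J) (f : {ffun J -> Z}) : {ffun J -> Z} :=
  [ffun j => if P j then f j else 0].

Fact maskf_is_linear P : linear (maskf P).
Proof.
move=> a f g; apply/ffunP => j; rewrite !ffunE.
by case: ifP => // _; rewrite scaler0 addr0.
Qed.
HB.instance Definition _ P := GRing.isLinear.Build rat _ _ _ (maskf P) (maskf_is_linear P).

Definition mask P : 'End({ffun J -> Z}) := linfun (maskf P).

Lemma maskE P f j : mask P f j = if P j then f j else 0.
Proof. by rewrite lfunE ffunE. Qed.

Definition supported (P : pred J) : {vspace {ffun J -> Z}} := lker (mask (predC P)).

Lemma supportedP P (f : {ffun J -> Z}) : reflect (forall j, ~~ P j -> f j = 0) (f \in supported P).
Proof.
rewrite memv_ker; apply: (iffP eqP) => [/ffunP Pf j Pj|Pf].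
  by have := Pf j; rewrite maskE /= Pj ffunE.
by apply/ffunP => j; rewrite maskE ffunE /=; case: ifP => // /Pf.
Qed.
End Mask.
Arguments mask {J Z} P.
Arguments supported {J Z} P.

(** * Tensor products of functors on subsets *)

Section Cubes.
Variable I : finType.

(* A functor [q |-> ctop q / cbot q] on the subsets of [I] ordered by reverse
   inclusion, realised as subquotients of one space [csp]. *)
Record cmod := Cmod {
  csp : vectType rat;
  cop : {set I} -> 'End(csp);
  ctop : {set I} -> {vspace csp};
  cbot : {set I} -> {vspace csp};
  cop0 : forall v, cop set0 v = v;
  copU : forall S T v, cop S (cop T v) = cop (S :|: T) v;
  cop_top : forall (S q : {set I}) v, S \subset q -> v \in ctop q -> cop S v \in ctop (q :\: S);
  cop_bot : forall (S q : {set I}) v, S \subset q -> v \in cbot q -> cop S v \in cbot (q :\: S);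
  cbot_top : forall q, (cbot q <= ctop q)%VS }.

(* A functor whose value at [q] has basis [cface q], the map to the value at
   [q :\ i] sending basis elements to basis elements by [cdel i]. *)
Record cset := Cset {
  cel : finType;
  cdel : I -> cel -> cel;
  cface : {set I} -> pred cel;
  cdelC : forall i j e, cdel i (cdel j e) = cdel j (cdel i e);
  cface_del : forall i (q : {set I}) e, i \notin q -> cface (i |: q) e -> cface q (cdel i e) }.

(* [{ffun cel B -> csp A}] is the tensor product of [csp A] with the space of
   basis [cel B]. *)
Definition tens (A : cmod) (B : cset) (i : I) (v : {ffun cel B -> csp A}) : {ffun cel B -> csp A} :=
  [ffun e => \sum_(x | cdel i x == e) cop A [set i] (v x)].

Fact tens_is_linear A B i : linear (@tens A B i).
Proof.
move=> a v w; apply/ffunP => e; rewrite !ffunE scaler_sumr -big_split.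
by apply: eq_bigr => x _; rewrite !ffunE linearP.
Qed.
HB.instance Definition _ A B i :=
  GRing.isLinear.Build rat _ _ _ (@tens A B i) (@tens_is_linear A B i).

Definition tens_bd A B := bd (fun i => @tens A B i : {linear _ -> _}).
Arguments tens_bd : clear implicits.

Lemma tensC A B i j v : @tens A B i (tens j v) = tens j (tens i v).
Proof.
have tE k l : @tens A B k (tens l v) =
    [ffun e => \sum_(x | cdel k (cdel l x) == e) cop A ([set k] :|: [set l]) (v x)].
  apply/ffunP => e; rewrite !ffunE.
  rewrite [RHS](partition_big (@cdel B l) (fun x => cdel k x == e)) //=.
  apply: eq_bigr => x /eqP <-; rewrite ffunE linear_sum /=.
  apply: eq_big => [y|y _]; last by rewrite copU.
  by case: eqP => [->|]; rewrite ?eqxx ?andbF.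
rewrite !tE; apply/ffunP => e; rewrite !ffunE.
by apply: eq_big => [x|x _]; [rewrite cdelC | rewrite setUC].
Qed.

(** Off the faces of [q] the value must be zero for numerator and denominator alike, so passing to
    the quotient only affects coefficients on faces. *)
Definition tens_in (Z : vectType rat) (M : {set I} -> {vspace Z}) (B : cset) (q : {set I})
    (v : {ffun cel B -> Z}) : Prop :=
  forall e, if cface q e then is_true (v e \in M q) else v e = 0.
Arguments tens_in {Z} M B q v.

Lemma tens_in_submod Z (M : {set I} -> {vspace Z}) B q : submodP (@tens_in Z M B q).
Proof.
split=> [e|a x y Mx My e]; rewrite !ffunE; first by case: ifP; rewrite ?mem0v.
by move: (Mx e) (My e); case: ifP => _ Px Py; [rewrite memvD ?memvZ|rewrite Px Py scaler0 addr0].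
Qed.

(** Sizes are shifted by one from homological degrees: a set of size [n] is a simplex of dimension
    [n - 1], so [L < n] means degree at least [L]. *)
Definition tleray A B L := forall T n, (L < n)%N ->
  exact (fun i => @tens A B i : {linear _ -> _}) (tens_in (ctop A) B) (tens_in (cbot A) B) T n.

Lemma tens_stab A B (M : {set I} -> {vspace csp A}) :
  (forall (S q : {set I}) v, S \subset q -> v \in M q -> cop A S v \in M (q :\: S)) ->
  forall i (q : {set I}) (v : {ffun cel B -> csp A}), i \notin q -> tens_in M B (i |: q) v -> tens_in M B q (tens i v).
Proof.
move=> MA i q v iq Mv e; rewrite ffunE; case: ifP => [eq|eq].
  apply: memv_suml => x /eqP xe; move: (Mv x); case: ifP => [_ /(MA [set i])|_ ->].
    by rewrite setU1K // sub1set setU11; apply.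
  by rewrite linear0 mem0v.
rewrite big1 // => x /eqP xe; move: (Mv x); case: ifP => [xq|_ ->]; last by rewrite linear0.
by move: (cface_del iq xq); rewrite xe eq.
Qed.

(** Tensoring [B] with this functor gives the chains of [B] with coefficients in [Z]. *)
Definition const_cmod (Z : vectType rat) : cmod.
refine (@Cmod Z (fun _ => \1%VF) (fun _ => fullv) (fun _ => 0%VS) _ _ _ _ _).
- by move=> v; rewrite id_lfunE.
- by move=> S T v; rewrite !id_lfunE.
- by move=> S q v _ _; rewrite memvf.
- by move=> S q v; rewrite id_lfunE.
- by move=> q; rewrite subvf.
Defined.

(** The unit of the tensor product: [tleray A unit_cset L] says that [A] itself is [L]-Leray. *)
Definition unit_cset : cset.
by refine (@Cset unit (fun _ e => e) (fun _ _ => true) _ _).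
Defined.

Section Embed.
Variables (A : cmod) (L : nat).
Let low (q s : {set I}) := (s \subset q) && (#|s| <= L)%N.

(* [v] in [A q] is sent to the family of its images in [A s] for the subsets [s] of
   [q] with at most [L] elements; [v - projv (cbot A s) v] represents the
   class of [v] modulo [cbot A s]. *)
Definition embf (q : {set I}) (v : csp A) : {ffun {set I} -> csp A} :=
  [ffun s => if low q s then cop A (q :\: s) v - projv (cbot A s) (cop A (q :\: s) v) else 0].

Fact embf_is_linear q : linear (embf q).
Proof.
move=> a v w; apply/ffunP => s; rewrite !ffunE; case: ifP => _; last by rewrite scaler0 addr0.
by rewrite linearP /= linearP /= scalerBr opprD addrACA.
Qed.
HB.instance Definition _ q := GRing.isLinear.Build rat _ _ _ (embf q) (embf_is_linear q).

Definition emb q : 'Hom(csp A, {ffun {set I} -> csp A}) := linfun (embf q).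

Lemma embE q v s :
  emb q v s = if low q s then cop A (q :\: s) v - projv (cbot A s) (cop A (q :\: s) v) else 0.
Proof. by rewrite lfunE ffunE. Qed.

(** Naturality of the embedding: for [s] disjoint from [S] both sides delete [q :\: s] in all, and
    the summands meeting [S] drop out. *)
Lemma emb_cop (S q : {set I}) v : S \subset q ->
  mask (fun s : {set I} => [disjoint S & s]) (emb q v) = emb (q :\: S) (cop A S v).
Proof.
move=> Sq; apply/ffunP => s; rewrite maskE !embE copU /low subsetD (disjoint_sym s).
case: ifP => [dS|_]; last by rewrite andbF.
rewrite andbT; case: ifP => // sq; suff -> : q :\: S :\: s :|: S = q :\: s by [].
apply/setP => i; rewrite !inE; have [iS|iS] := boolP (i \in S); last by rewrite orbF.
by rewrite (subsetP Sq) // orbT andbT (disjointFr dS iS).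
Qed.

Lemma emb_bot q v : v \in cbot A q -> emb q v = 0.
Proof.
move=> vq; apply/ffunP => s; rewrite embE ffunE; case: ifP => // /andP[sq _].
rewrite projv_id ?subrr //.
have := cop_bot (subsetDl q s) vq.
by rewrite setDDr setDv set0U (setIidPr sq).
Qed.

(** Two functors in one record: [ctop] alone is the direct sum over [s] of constant functors
    truncated to the [q] containing [s], and [ctop / cbot] is the cokernel of [A] in it. *)
Definition embedding : cmod.
refine (@Cmod {ffun {set I} -> csp A}
  (fun S => mask (fun s : {set I} => [disjoint S & s])) (fun q => supported (low q))
  (fun q => emb q @: ctop A q)%VS _ _ _ _ _).
- by move=> v; apply/ffunP => s; rewrite maskE -setI_eq0 set0I eqxx.
- move=> S T v; apply/ffunP => s; rewrite !maskE.
  by rewrite -!setI_eq0 setIUl setU_eq0; case: ifP.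
- move=> S q v Sq /supportedP vq; apply/supportedP => s; rewrite maskE => sq.
  case: ifP => // dS; apply: vq; apply: contra sq.
  by rewrite /low subsetD (disjoint_sym s) dS andbT.
- move=> S q v Sq /memv_imgP[w wq ->]; rewrite emb_cop //.
  by apply: memv_img; apply: cop_top.
- move=> q; apply/subvP => v /memv_imgP[w wq ->]; apply/supportedP => s sq.
  by rewrite embE (negPf sq).
Defined.

Lemma emb_tens B i (q : {set I}) (v : {ffun cel B -> csp A}) : i \notin q ->
  @tens embedding B i [ffun e => emb (i |: q) (v e)] = [ffun e => emb q (tens i v e)].
Proof.
move=> iq; apply/ffunP => e; rewrite !ffunE linear_sum; apply: eq_bigr => x _.
by rewrite ffunE [LHS]emb_cop ?sub1set ?setU11 // setU1K.
Qed.

Definition emb_chain (B : cset) (z : {ffun {set I} -> {ffun cel B -> csp A}}) :=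
  [ffun q => [ffun e => emb q (z q e)]].

Lemma bd_emb_chain B z : tens_bd embedding B (emb_chain z) = emb_chain (tens_bd A B z).
Proof.
apply/ffunP => q; rewrite /tens_bd bdE ffunE; apply/ffunP => e.
rewrite sum_ffunE ffunE bdE sum_ffunE linear_sum; apply: eq_bigr => i iq.
have /ffunP/(_ e) : @tens embedding B i (emb_chain z (i |: q)) =
    [ffun e => emb q (tens i (z (i |: q)) e)] by rewrite -emb_tens // [emb_chain z _]ffunE.
rewrite [RHS]ffunE => tE; rewrite [RHS](_ : _ = emb q (sg i q *: tens i (z (i |: q)) e)).
  by rewrite linearZ /= -tE ffunE.
by rewrite ffunE.
Qed.

Definition comp B (s : {set I}) (z : {ffun {set I} -> {ffun cel B -> csp embedding}}) :
  {ffun {set I} -> {ffun cel B -> csp A}} := [ffun q => [ffun e => z q e s]].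

Lemma sum_embedding (J : finType) (P : pred J) (F : J -> csp embedding) s :
  (\sum_(j | P j) F j : {ffun {set I} -> csp A}) s =
  \sum_(j | P j) (F j : {ffun {set I} -> csp A}) s.
Proof. exact: sum_ffunE. Qed.

(** An [i] outside [q] is outside [s], so the mask fixes component [s]: above [s] this component is
    a chain of [B] with constant coefficients. *)
Lemma bd_comp B (s q : {set I}) z e : s \subset q ->
  (tens_bd embedding B z q e : {ffun {set I} -> csp A}) s = tens_bd (const_cmod (csp A)) B (comp s z) q e.
Proof.
move=> sq; rewrite /tens_bd !bdE !sum_ffunE; apply: eq_bigr => i iq.
rewrite !ffunE sum_embedding; congr (_ *: _); apply: eq_bigr => x _.
rewrite maskE id_lfunE !ffunE disjoints1.
by rewrite (contra (subsetP sq i) iq).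
Qed.

(** This concerns the direct sum, not the cokernel. Its summand at [s] is the link complex of
    [exact_link], exact in sizes above [LB + #|s|], and [#|s| <= L]. *)
Lemma exact_embedding B LB T n : tleray (const_cmod (csp A)) B LB -> (L + LB < n)%N ->
  exact (fun i => @tens embedding B i : {linear _ -> _}) (tens_in (ctop embedding) B)
    (@is_zero _ _) T n.
Proof.
move=> hB Ln z zT Mz dz.
have zM q e s : ~~ low q s -> (z q e : {ffun {set I} -> csp A}) s = 0.
  move=> lq; have := Mz q e; case: ifP => [_ /supportedP -> //|_ ->].
  by rewrite ffunE.
have /fin_all_exists[W HW] (s : {set I}) : exists w : {ffun {set I} -> {ffun cel B -> csp A}},
    [/\ supp T n.+1 w, forall q : {set I}, tens_in (fun=> fullv) B q (w q),
     forall q : {set I}, ~~ (s \subset q) -> w q = 0 &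
     (#|s| <= L)%N -> forall q : {set I}, s \subset q -> comp s z q = tens_bd (const_cmod (csp A)) B w q].
  have [sL|sL] := boolP (#|s| <= L)%N; last first.
    exists 0; split => // [q _|q|q _]; rewrite ?ffunE //.
    by case: (tens_in_submod (fun=> fullv : {vspace csp A}) B q).
  have [|||||||||w [wT Mw ws zw]] := @exact_link _ _
      (fun i => @tens (const_cmod (csp A)) B i : {linear _ -> _}) (tens_in (fun=> fullv) B) LB
      _ _ _ _ s T n _ (comp s z).
  - exact: tensC.
  - by move=> q; apply: tens_in_submod.
  - exact: (@tens_stab (const_cmod (csp A)) B (fun=> fullv) (@cop_top (const_cmod (csp A)))).
  - move=> T' n' Ln' y yT My dy.
    have [|w [wT Mw yw]] := hB T' n' Ln' y yT My.
      by move=> q e; rewrite dy ffunE; case: ifP; rewrite // mem0v.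
    exists w; split=> // q; apply/ffunP => e; rewrite [RHS]ffunE; move: (yw q e).
    by case: ifP => // _; rewrite memv0 => /eqP.
  - by rewrite addnC; apply: leq_ltn_trans Ln; rewrite leq_add2r.
  - by move=> q qT; apply/ffunP => e; rewrite !ffunE zT // !ffunE.
  - move=> q e; rewrite !ffunE; case: ifP => [_|eq]; first exact: memvf.
    by have := Mz q e; rewrite eq => ->; rewrite ffunE.
  - by move=> q sq; apply/ffunP => e; rewrite !ffunE zM // /low (negPf sq).
  - move=> q sq; apply/ffunP => e; rewrite -[LHS]bd_comp //.
    by rewrite /tens_bd dz !ffunE.
  by exists w.
pose w : {ffun {set I} -> {ffun cel B -> csp embedding}} :=
  [ffun q => [ffun e => [ffun s : {set I} => if (#|s| <= L)%N then W s q e else 0]]].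
exists w; split.
- move=> q qT; apply/ffunP => e; apply/ffunP => s; rewrite !ffunE.
  by case: (HW s) => wT _ _ _; rewrite wT // ffunE if_same.
- move=> q e; case: ifP => [eq|eq].
    apply/supportedP => s; rewrite !ffunE /low negb_and.
    case: ifP => // _; rewrite orbF => sq.
    by case: (HW s) => _ _ Ws _; rewrite Ws // ffunE.
  apply/ffunP => s; rewrite !ffunE; case: ifP => // _.
  by case: (HW s) => _ /(_ q e); rewrite eq.
move=> q; apply/eqP; rewrite subr_eq0; apply/eqP/ffunP => e; apply/ffunP => s.
case: (HW s) => _ _ Ws zW.
have [lq|lq] := boolP (low q s).
  case/andP: (lq) => sq sL.
  have -> : (z q e : {ffun {set I} -> csp A}) s = tens_bd (const_cmod (csp A)) B (W s) q e.
    by rewrite -zW // !ffunE.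
  rewrite -[RHS]/((tens_bd embedding B w q e : {ffun {set I} -> csp A}) s) bd_comp //.
  suff -> : comp s w = W s by [].
  by apply/ffunP => q'; apply/ffunP => e'; rewrite !ffunE sL.
(* Here a term could survive only if [s] avoids [i] and lies in [i |: q], hence in [q], which is
   excluded. *)
rewrite zM // bdE !sum_ffunE big1 // => i iq.
rewrite !ffunE sum_embedding big1 ?scaler0 // => x _.
rewrite maskE disjoints1 !ffunE; case: ifP => // si; case: ifP => // sL.
rewrite Ws ?ffunE //; move: lq; rewrite /low sL andbT; apply: contra => sq.
by rewrite -(setU1K iq) subsetD1 sq.
Qed.
End Embed.
End Cubes.
Arguments tens_in {I Z} M B q v.
Arguments tens_bd {I} A B z.

(** * Leray bounds for tensor products *)

Section Product.
Variable I : finType.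
Implicit Types (A : cmod I) (B : cset I) (q T : {set I}).

(** With [B] constant this is the augmented chain complex of the full simplex on [T], contracted by
    coning from a vertex [x]. *)
Lemma simplex_leray Z B : (forall i e, cdel (c := B) i e = e) -> (forall q e, cface (c := B) q e) ->
  tleray (const_cmod I Z) B 0.
Proof.
move=> Bdel Bface T n n0 z zT _ dz.
have tensE i (v : {ffun cel B -> Z}) : @tens I (const_cmod I Z) B i v = v.
  apply/ffunP => e; rewrite ffunE (big_pred1 e) ?id_lfunE // => x.
  by rewrite Bdel.
have {}dz q : \sum_(i | i \notin q) sg i q *: z (i |: q) = 0.
  apply/ffunP => e; rewrite [RHS]ffunE; apply/eqP.
  have := dz q e; rewrite Bface memv0 bdE; move/eqP <-; apply/eqP.
  congr (fun_of_fin _ e); apply: eq_bigr => i _; congr (_ *: _); exact/esym/tensE.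
(* An empty [T] has no subset of the positive size [n]. *)
case: (set_0Vmem T) => [T0|[x xT]].
  exists 0; split=> [q _|q e|q e]; rewrite ?Bface ?memvf //; first by rewrite ffunE.
  rewrite bd0 !ffunE subr0 zT ?ffunE ?mem0v // T0 subset0.
  by apply/negP => /andP[/eqP->]; rewrite cards0 => /eqP n00; rewrite -n00 in n0.
exists [ffun q : {set I} => if x \in q then sg x q *: z (q :\ x) else 0]; split.
- move=> q qT; rewrite ffunE; case: ifP => // xq; rewrite zT ?scaler0 //.
  apply: contra qT => /andP[qT /eqP cq]; rewrite (cardsD1 x q) xq cq add1n eqxx andbT.
  by rewrite -(setD1K xq) subUset sub1set xT.
- by move=> q e; rewrite Bface; apply: memvf.
move=> q e; rewrite Bface memv0 !ffunE subr_eq0; apply/eqP; congr (fun_of_fin _ e).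
transitivity (\sum_(i | i \notin q) (sg i q * sg x (i |: q)) *:
    (if x \in i |: q then z ((i |: q) :\ x) else 0)); last first.
  apply: eq_bigr => i iq; rewrite ffunE; case: ifP => xi; last first.
    by rewrite scaler0; apply/esym; rewrite linear0 scaler0.
  by rewrite -scalerA; congr (_ *: _); apply/esym/tensE.
have [xq|xq] := boolP (x \in q); last first.
  rewrite (bigD1 x) //= setU11 setU1K // sgUid sg_sq scale1r big1 ?addr0 // => i /andP[_ ix].
  by rewrite inE (negPf xq) orbF inE eq_sym (negPf ix) scaler0.
pose p := q :\ x; have xp : x \notin p by rewrite !inE eqxx.
have qE : q = x |: p by rewrite setD1K.
(* The cycle condition at [p] expresses [z q] through the other sets [i |: p], which supply the
   terms of the boundary of the cone. *)
have := dz p; rewrite (bigD1 x) //= -qE => /eqP; rewrite addr_eq0 => /eqP zq.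
have : z q = sg x p *: (sg x p *: z q) by rewrite scalerA sg_sq scale1r.
rewrite zq scalerN scaler_sumr -sumrN => ->; apply: eq_big => [i|i /andP[ip ix]].
  by rewrite qE in_setU1 negb_or andbC.
have xip : x \notin i |: p by rewrite !inE eqxx eq_sym (negPf ix).
have -> : i |: q = x |: (i |: p) by rewrite qE setUCA.
rewrite setU11 setU1K // sgUid [in RHS]qE scalerA -scaleNr; congr (_ *: _).
have dE : sg i (x |: p) = - (sg x p * (sg i p * sg x (i |: p))).
  have ->: sg i p * sg x (i |: p) = - (sg x p * sg i (x |: p)) by rewrite sg_anti.
  by rewrite mulrN opprK mulrA sg_sq mul1r.
by rewrite dE mulNr -!mulrA sg_sq mulr1.
Qed.


Section EmbedLeray.
Variables (A : cmod I) (L : nat).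
Hypothesis hA : tleray A (unit_cset I) L.

(* If [#|q| > L], exactness on [T = q] in the top size says that a class of
   [A q] vanishes as soon as its images in all the [A (q :\ i)] do. *)
Lemma emb_inj q v : v \in ctop A q -> emb A L q v = 0 -> v \in cbot A q.
Proof.
move: {2}#|q| (erefl #|q|) => k; elim: k q v => [|k IHk] q v qk vq ev.
all: have [qL|qL] := leqP #|q| L.
(* If [#|q| <= L], the component [s = q] of the embedding is [v] minus its projection to
   [cbot A q]. *)
all: try by move/ffunP/(_ q): ev;
  rewrite embE subxx qL setDv cop0 ffunE => /eqP; rewrite subr_eq0 => /eqP ->; apply: memv_proj.
  by rewrite qk in qL.
pose z : {ffun {set I} -> {ffun cel (unit_cset I) -> csp A}} :=
  [ffun p => [ffun e => if p == q then v else 0]].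
have zT : supp q #|q| z.
  move=> p pq; apply/ffunP => e; rewrite !ffunE.
  by case: (eqVneq p q) pq => // ->; rewrite subxx eqxx.
have Mz p : tens_in (ctop A) (unit_cset I) p (z p).
  by move=> e; rewrite !ffunE; case: eqP => [->|]; rewrite ?mem0v.
have [p|w [wT _ zw]] := hA qL zT Mz.
  rewrite bdE; apply: submodP_sum => [|i ip]; first exact: tens_in_submod.
  apply: (submodPZ _ (tens_in_submod (cbot A) (unit_cset I) p)).
  move=> [] /=; rewrite ffunE; apply: memv_suml => -[] _; rewrite !ffunE.
  case: eqP => [piq|_]; last by rewrite linear0 mem0v.
  have iq : i \in q by rewrite -piq setU11.
  have <- : q :\ i = p by rewrite -piq setU1K.
  apply: IHk.
  - by move: qk; rewrite (cardsD1 i) iq => -[].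
  - by apply: cop_top; rewrite ?sub1set.
  by rewrite -emb_cop ?sub1set // ev linear0.
(* No subset of [q] has size [#|q|.+1], so nothing but zero can bound [z]. *)
suff w0 : w = 0 by have := zw q tt; rewrite w0 bd0 /= !ffunE eqxx subr0.
apply/ffunP => p; rewrite wT ?ffunE //; apply/negP => /andP[/subset_leq_card pq /eqP pk].
by rewrite pk ltnn in pq.
Qed.

(** Preimages are chosen pointwise, with 0 chosen over 0 so that the support does not grow. *)
Lemma emb_lift B T n x : supp T n x ->
  (forall q, tens_in (fun q => emb A L q @: ctop A q)%VS B q (x q)) ->
  exists u, [/\ supp T n u, forall q, tens_in (ctop A) B q (u q) & emb_chain L u = x].
Proof.
move=> xT Mx.
have /fin_all_exists[f Hf] (p : {set I} * cel B) : exists v : csp A,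
    [/\ x p.1 p.2 = 0 -> v = 0, x p.1 p.2 = emb A L p.1 v &
     if cface p.1 p.2 then is_true (v \in ctop A p.1) else v = 0].
  have [x0|x0] := eqVneq (x p.1 p.2) 0.
    by exists 0; split=> //; [rewrite x0 linear0|rewrite mem0v; case: ifP].
  have := Mx p.1 p.2; case: ifP => _ xp; last by rewrite xp eqxx in x0.
  by case/memv_imgP: xp => v vM xE; exists v; split => // x00; rewrite x00 eqxx in x0.
exists [ffun q => [ffun e => f (q, e)]]; split.
- move=> q qT; apply/ffunP => e; rewrite !ffunE.
  by case: (Hf (q, e)) => -> //; rewrite /= xT // ffunE.
- by move=> q e; rewrite !ffunE; case: (Hf (q, e)).
by apply/ffunP => q; apply/ffunP => e; rewrite !ffunE; case: (Hf (q, e)).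
Qed.

Lemma emb_chainB B (x y : {ffun {set I} -> {ffun cel B -> csp A}}) :
  emb_chain L (x - y) = emb_chain L x - emb_chain L y.
Proof. by apply/ffunP => q; apply/ffunP => e; rewrite !ffunE linearB. Qed.

Lemma supp_emb_chain B T n (x : {ffun {set I} -> {ffun cel B -> csp A}}) :
  supp T n x -> supp T n (emb_chain L x).
Proof. by move=> xT q qT; apply/ffunP => e; rewrite !ffunE xT // ffunE linear0. Qed.

Lemma emb_chain_img B (x : {ffun {set I} -> {ffun cel B -> csp A}}) :
  (forall q, tens_in (ctop A) B q (x q)) ->
  forall q, tens_in (fun q => emb A L q @: ctop A q)%VS B q (emb_chain L x q).
Proof.
move=> Mx q e; rewrite !ffunE; have := Mx q e; case: ifP => _.
  by move=> xM; apply: memv_img.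
by move->; rewrite linear0.
Qed.

Lemma emb_chain_top B (x : {ffun {set I} -> {ffun cel B -> csp A}}) :
  (forall q, tens_in (ctop A) B q (x q)) ->
  forall q, tens_in (ctop (embedding A L)) B q (emb_chain L x q).
Proof.
move=> Mx q e; have := emb_chain_img Mx q e; case: ifP => // _.
exact: (subvP (cbot_top (embedding A L) q)).
Qed.

Lemma emb_chain_bot B (x : {ffun {set I} -> {ffun cel B -> csp A}}) :
  (forall q, tens_in (ctop A) B q (x q)) -> emb_chain L x = 0 ->
  forall q, tens_in (cbot A) B q (x q).
Proof.
move=> Mx x0 q e; have := Mx q e; case: ifP => // _ xM; apply: emb_inj => //.
by move/ffunP/(_ q)/ffunP/(_ e): x0; rewrite !ffunE.
Qed.

Lemma emb_chain_bot0 B (x : {ffun {set I} -> {ffun cel B -> csp A}}) :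
  (forall q, tens_in (cbot A) B q (x q)) -> emb_chain L x = 0.
Proof.
move=> Nx; apply/ffunP => q; apply/ffunP => e; rewrite !ffunE.
by have := Nx q e; case: ifP => [_ /emb_bot->|_ ->]; rewrite ?linear0.
Qed.

(** The connecting map of the short exact sequence: the boundary of a cycle [z] of the cokernel
    lifts to a cycle [y] of [A], one size lower, which bounds some [w]; then [z] minus the image of
    [w] is a cycle of the direct sum and bounds there. *)
Lemma embedding_leray : tleray (embedding A L) (unit_cset I) L.+1.
Proof.
move=> T [//|n] Ln z zT Mz dz.
have [y [yT My yE]] := emb_lift (supp_bd _ zT) dz.
have My' := bd_in (tens_in_submod _ (unit_cset I)) (@tens_stab I A (unit_cset I) _ (@cop_top I A)) My.
have [|w [wT Mw yw]] := hA Ln yT My.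
  apply: emb_chain_bot => //; rewrite -[LHS]bd_emb_chain yE; exact: (bd_bd _ (@tensC I (embedding A L) (unit_cset I))).
have dw : emb_chain L y = emb_chain L (tens_bd A (unit_cset I) w).
  by apply/eqP; rewrite -subr_eq0 -emb_chainB; apply/eqP/emb_chain_bot0 => q; rewrite chainB.
have Mw' := emb_chain_top Mw.
have [|||||w' [wT' Mw'' zw]] := @exact_embedding I A L (unit_cset I) 0 T n.+1 _ _ (z - emb_chain L w).
- exact: simplex_leray.
- by rewrite addn0 ltnW.
- exact/supp_sub/supp_emb_chain.
- by move=> q; rewrite chainB; apply: (submodPB (tens_in_submod _ _ q)).
- move=> q; rewrite bdB -[bd _ (emb_chain L w)]/(tens_bd (embedding A L) (unit_cset I) (emb_chain L w)).
  by rewrite bd_emb_chain -dw yE chainB; apply: subrr.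
exists w'; split=> // q; suff -> : z q - tens_bd (embedding A L) (unit_cset I) w' q = emb_chain L w q.
  exact: emb_chain_img.
by have /eqP := zw q; rewrite chainB addrAC subr_eq0 => /eqP.
Qed.
End EmbedLeray.

(* Descending induction on [n]: replacing [A] by the cokernel of its embedding
   raises both [n] and [LA] by one, and there is nothing left once [n] exceeds [#|T|]. *)
Lemma tensor_leray A B LA LB : tleray A (unit_cset I) LA -> (forall Z, tleray (const_cmod I Z) B LB) ->
  tleray A B (LA + LB).
Proof.
move=> hA hB T n; have [k] : {k | (#|T| < n + k)%N} by exists #|T|.+1; rewrite addnS ltnS leq_addl.
elim: k n A LA hA => [|k IHk] n A LA hA Tn Ln z zT Mz dz.
  have z0 : z = 0.
    apply/ffunP => q; rewrite zT ?ffunE //; apply/negP => /andP[/subset_leq_card qT /eqP qn].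
    by rewrite addn0 ltnNge -qn qT in Tn.
  exists 0; split=> [q _|q|q].
  - by rewrite ffunE.
  - by rewrite -z0.
  - by rewrite bd0 z0 subrr; case: (tens_in_submod (cbot A) B q).
(* The image of [z] bounds some [w] in the direct sum, and [w] is then a cycle of the cokernel. *)
have [|w [wT Mw zw]] := exact_embedding (L := LA) (hB (csp A)) Ln (supp_emb_chain LA zT) (emb_chain_top LA Mz).
  move=> q; rewrite -[bd _ _]/(tens_bd (embedding A LA) B (emb_chain LA z)) bd_emb_chain.
  by rewrite (emb_chain_bot0 _ dz) ffunE.
have dw : tens_bd (embedding A LA) B w = emb_chain LA z.
  by apply/ffunP => q; have /eqP := zw q; rewrite subr_eq0 => /eqP.
have [||q|y [yT My wy]] := IHk n.+1 _ _ (embedding_leray hA) _ _ w wT Mw.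
- by rewrite addSnnS.
- by rewrite addSn.
- by rewrite -[bd _ _]/(tens_bd (embedding A LA) B w) dw; apply: emb_chain_img.
(* Corrected by a boundary, [w] comes from a chain [u] of [A]; [z] and the boundary of [u] have the
   same image, so they agree by injectivity of the embedding. *)
have wyT : supp T n.+1 (w - tens_bd (embedding A LA) B y) by apply/supp_sub/supp_bd.
have [|u [uT Mu uE]] := emb_lift wyT (L := LA).
  by move=> q; rewrite chainB; apply: wy.
exists u; split=> // q; rewrite -chainB.
move: q; apply: (emb_chain_bot hA) => [q|].
  rewrite chainB; apply: (submodPB (tens_in_submod _ _ q)) => //.
  exact: (bd_in (tens_in_submod _ B) (@tens_stab I A B _ (@cop_top I A)) Mu).
rewrite emb_chainB -dw -[bd _ u]/(tens_bd A B u) -bd_emb_chain uE [tens_bd _ _ (_ - _)]bdB.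
by rewrite [X in _ - (_ - X)](bd_bd _ (@tensC I (embedding A LA) B)) subr0 subrr.
Qed.
End Product.

(** * Reduced homology of a simplicial complex *)

Section Homology.
Variable T : finType.
Implicit Types (K : {set {set T}}) (s q : {set T}).

Definition simplicial_bd := bd (fun _ : T => idfun : {linear rat^o -> rat^o}).
Definition in_complex K q (v : rat^o) := (q \in K) || (v == 0).
Definition complex_exact K n := exact (fun _ : T => idfun : {linear rat^o -> rat^o})
  (fun q v => in_complex K q v) (@is_zero T rat^o) setT n.

Lemma simplicial_bdE (z : {ffun {set T} -> rat^o}) q :
  simplicial_bd z q = \sum_(v | v \notin q) sg v q * z (v |: q).
Proof. by rewrite /simplicial_bd bdE. Qed.

Let row_of (z : {ffun {set T} -> rat^o}) : 'rV[rat]_(nsets T) := \row_a z (sidx a).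
Let of_row (u : 'rV[rat]_(nsets T)) : {ffun {set T} -> rat^o} :=
  [ffun s => u 0 (enum_rank s)].

Let row_ofK z : of_row (row_of z) = z.
Proof. by apply/ffunP => s; rewrite ffunE mxE /sidx enum_rankK. Qed.
Let of_rowK u : row_of (of_row u) = u.
Proof. by apply/rowP => a; rewrite mxE ffunE /sidx enum_valK. Qed.

(** The rows of [bdry_mx K i] outside the [i]-simplices of [K] vanish, whence the truncation of
    [z]. *)
Lemma bdry_mxE K i (z : {ffun {set T} -> rat^o}) :
  row_of z *m bdry_mx K i =
  row_of (simplicial_bd [ffun s => if (s \in K) && (#|s| == i.+1) then z s else 0]).
Proof.
apply/rowP => b; rewrite !mxE simplicial_bdE.
rewrite (reindex_onto enum_rank (sidx (T := T))) => [|a _]; last exact: enum_valK.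
rewrite (eq_bigl xpredT) => [|s]; last by rewrite /sidx enum_rankK eqxx.
set t := sidx b.
transitivity (\sum_(s : {set T}) \sum_(v | (v \in s) && (t == s :\ v))
    sg v s * (if (s \in K) && (#|s| == i.+1) then z s else 0)).
  apply: eq_bigr => s _; rewrite !mxE /sidx enum_rankK -/(sidx b) -/t /bdry_coef.
  case: ifP => _; last by rewrite mulr0 big1 // => v _; rewrite mulr0.
  by rewrite mulr_sumr; apply: eq_bigr => v _; rewrite mulrC.
(* For a fixed deleted vertex [v], the only set with face [t] is [v |: t]. *)
rewrite (exchange_big_dep xpredT) //= [RHS]big_mkcond; apply: eq_bigr => v _.
have [vt|vt] := boolP (v \in t).
  by rewrite big1 // => s /andP[_ /eqP ts]; rewrite ts !inE eqxx in vt.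
rewrite (big_pred1 (v |: t)) ?sgUid ?ffunE // => s; apply/andP/eqP => [[vs /eqP->]|->].
  by rewrite setD1K.
by rewrite setU11 setU1K.
Qed.

(** The shift is that from dimension to size. On chains supported on simplices of the right size the
    truncation in [bdry_mxE] does nothing. *)
Lemma rhom_vanishP K i : rhom_vanish K i <-> complex_exact K i.+1.
Proof.
have restrE (z : {ffun {set T} -> rat^o}) n : supp setT n z -> (forall q, in_complex K q (z q)) ->
    [ffun s => if (s \in K) && (#|s| == n) then z s else 0] = z.
  move=> zT Kz; apply/ffunP => s; rewrite ffunE; case: ifP => // /negbT.
  rewrite negb_and => /orP[sK|sn]; first by have := Kz s; rewrite /in_complex (negPf sK) => /eqP.
  by rewrite zT // (negPf sn) andbF.
have restr_supp (z : {ffun {set T} -> rat^o}) n :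
    supp setT n [ffun s : {set T} => if (s \in K) && (#|s| == n) then z s else 0 : rat^o].
  by move=> s; rewrite subsetT ffunE /= => /negPf ->; rewrite andbF.
have restr_in (z : {ffun {set T} -> rat^o}) n q :
    in_complex K q ([ffun s : {set T} => if (s \in K) && (#|s| == n) then z s else 0 : rat^o] q).
  by rewrite /in_complex ffunE; case: (q \in K).
have chainP z n : reflect (supp setT n.+1 z /\ forall q, in_complex K q (z q)) (row_of z <= chain_mx K n)%MS.
  apply: (iffP submxP) => [[D zD]|[zT Kz]].
    have zE s : z s = D 0 (enum_rank s) * (if (s \in K) && (#|s| == n.+1) then 1 else 0).
      move/rowP/(_ (enum_rank s)): zD; rewrite mxE /sidx enum_rankK => ->.
      by rewrite mul_mx_diag !mxE /sidx enum_rankK.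
    split=> s; first by rewrite subsetT zE /= => /negPf ->; rewrite andbF mulr0.
    by rewrite /in_complex zE; case: (s \in K) => //=; rewrite mulr0.
  exists (row_of z); apply/rowP => a; rewrite mul_mx_diag !mxE -{1}(restrE z n.+1) //.
  by rewrite ffunE; case: ifP; rewrite ?mulr1 ?mulr0.
split=> [/rV_subP hK z zT Kz dz|hK].
  have [|D] := submxP (hK (row_of z) _).
    rewrite sub_capmx; apply/andP; split; last exact/chainP.
    apply/sub_kermxP; rewrite bdry_mxE restrE //; apply/rowP => a; rewrite !mxE.
    by apply: dz.
  rewrite -(of_rowK D) bdry_mxE => /(congr1 of_row); rewrite !row_ofK => zE.
  eexists; split; last by move=> q; rewrite {1}zE; apply: subrr.
  - exact: restr_supp.
  - by move=> q; apply: restr_in.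
apply/rV_subP => u; rewrite -(of_rowK u); set z := of_row u.
rewrite sub_capmx => /andP[/sub_kermxP dz /chainP[zT Kz]].
have [|w [wT Kw zw]] := hK z zT Kz.
  by move=> q; move: dz; rewrite bdry_mxE restrE // => /(congr1 of_row)/ffunP/(_ q);
     rewrite row_ofK [RHS]ffunE mxE.
apply/submxP; exists (row_of w); rewrite bdry_mxE restrE //; congr row_of.
by apply/ffunP => q; apply/subr0_eq/zw.
Qed.

End Homology.

(** * From rational coefficients to coefficients in a vector space *)

Section Coordinates.
Variables (I : finType) (B : cset I).

Definition mapc (Z Z' : vectType rat) (f : Z -> Z') (z : {ffun {set I} -> {ffun cel B -> Z}}) :
    {ffun {set I} -> {ffun cel B -> Z'}} :=
  [ffun q => [ffun e => f (z q e)]].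

Lemma bd_mapc (Z Z' : vectType rat) (f : {linear Z -> Z'}) z :
  tens_bd (const_cmod I Z') B (mapc f z) = mapc f (tens_bd (const_cmod I Z) B z).
Proof.
apply/ffunP => q; apply/ffunP => e; rewrite /tens_bd bdE sum_ffunE !ffunE sum_ffunE linear_sum /=.
apply: eq_bigr => i iq; rewrite !ffunE linearZ [in RHS]linear_sum /=; congr (_ *: _).
by apply: eq_bigr => x _; rewrite !id_lfunE !ffunE.
Qed.

Definition scalev (Z : vectType rat) (v : Z) (a : rat^o) : Z := a *: v.
Fact scalev_is_linear (Z : vectType rat) (v : Z) : linear (@scalev Z v).
Proof. by move=> a x y; rewrite /scalev scalerDl scalerA. Qed.
HB.instance Definition _ (Z : vectType rat) (v : Z) :=
  GRing.isLinear.Build rat rat^o Z _ (@scalev Z v) (@scalev_is_linear Z v).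

Definition coordv (Z : vectType rat) (k : 'I_(\dim {:Z})) (v : Z) : rat^o :=
  coord (vbasis {:Z}) k v.
Fact coordv_is_linear (Z : vectType rat) k : linear (@coordv Z k).
Proof. by move=> a x y; rewrite /coordv linearP. Qed.
HB.instance Definition _ (Z : vectType rat) k :=
  GRing.isLinear.Build rat Z rat^o _ (@coordv Z k) (@coordv_is_linear Z k).

(** Each coordinate of the cycle in a basis of [Z] is bounded separately, and the bounding chains
    are recombined. *)
Lemma leray_coef L Z : tleray (const_cmod I rat^o) B L -> tleray (const_cmod I Z) B L.
Proof.
move=> hB T n Ln z zT Mz dz; pose b := vbasis {:Z}.
have dz0 : tens_bd (const_cmod I Z) B z = 0.
  apply/ffunP => q; apply/ffunP => e; rewrite [RHS](_ : _ = 0); last by rewrite !ffunE.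
  by have := dz q e; case: ifP => // _ h; apply/eqP; rewrite -memv0.
have /fin_all_exists[w Hw] (k : 'I_(\dim {:Z})) : exists w : {ffun {set I} -> {ffun cel B -> rat^o}},
    [/\ supp T n.+1 w, forall q, tens_in (fun=> fullv) B q (w q) &
    mapc (@coordv Z k) z = tens_bd (const_cmod I rat^o) B w].
  have [|q e|q e|w [wT Mw zw]] := hB T n Ln (mapc (@coordv Z k) z).
  - by move=> q qT; apply/ffunP => e; rewrite !ffunE zT // !ffunE linear0.
  - rewrite !ffunE; case: ifP => eq; first exact: memvf.
    by have := Mz q e; rewrite eq => ->; rewrite linear0.
  - rewrite -[bd _ _]/(tens_bd (const_cmod I rat^o) B _) bd_mapc dz0 !ffunE linear0.
    by case: ifP; rewrite // mem0v.
  exists w; split=> //; apply/ffunP => q; apply/ffunP => e; apply/eqP.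
  by rewrite -subr_eq0; have := zw q e; rewrite !ffunE; case: ifP => [_|_ ->]; rewrite ?memv0.
exists (\sum_(k < \dim {:Z}) mapc (scalev b`_k) (w k)); split.
- move=> q qT; rewrite sum_ffunE big1 // => k _; apply/ffunP => e; rewrite !ffunE.
  by case: (Hw k) => -> //; rewrite ffunE linear0.
- move=> q e; case: ifP => eq; first exact: memvf.
  rewrite !sum_ffunE big1 // => k _; rewrite !ffunE.
  by case: (Hw k) => _ /(_ q e); rewrite eq => -> _; rewrite linear0.
suff bw : tens_bd (const_cmod I Z) B (\sum_(k < \dim {:Z}) mapc (scalev b`_k) (w k)) = z.
  by move=> q e; rewrite -[bd _ _]/(tens_bd (const_cmod I Z) B _) bw !ffunE subrr; case: ifP; rewrite // mem0v.
rewrite [LHS]bd_sum; apply/ffunP => q; apply/ffunP => e; rewrite !sum_ffunE.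
rewrite [RHS](coord_vbasis (memvf _)); apply: eq_bigr => k _.
rewrite -[bd _ _]/(tens_bd (const_cmod I Z) B (mapc (scalev b`_k) (w k))) bd_mapc.
by case: (Hw k) => _ _ <-; rewrite !ffunE.
Qed.
End Coordinates.

(** * Tuples of simplices with a common image *)

Section Lifts.
Variables (W I : finType) (c : W -> I) (X : {set {set W}}).
Hypothesis hX : is_complex X.
Implicit Types (s : {set W}) (q : {set I}).

Definition lifts q : {set {set W}} := [set s in X | c @: s == q].
Definition delc (S : {set I}) s := s :\: (c @^-1: S).

Lemma delcU S S' s : delc S (delc S' s) = delc (S :|: S') s.
Proof. by rewrite /delc preimsetU setUC setDDl. Qed.

Lemma lifts_delc (S : {set I}) q s : S \subset q -> s \in lifts q -> delc S s \in lifts (q :\: S).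
Proof.
move=> Sq; rewrite !inE => /andP[sX /eqP sq]; rewrite (hX sX) ?subsetDl //=.
apply/eqP/setP => i; rewrite -sq; apply/imsetP/setDP => [[v]|[/imsetP[v vs ->] iS]].
  by rewrite !inE => /andP[vS vs] ->; rewrite imset_f.
by exists v; rewrite // !inE iS.
Qed.

(** The basis of the [k]-th tensor power of the span of the lifts. For [k = 0] the empty tuple is a
    face of every [q], which gives the full simplex. *)
Definition tuples (k : nat) : cset I.
refine (@Cset I {ffun 'I_k -> {set W}} (fun i e => [ffun j => delc [set i] (e j)])
  (fun q e => [forall j, e j \in lifts q]) _ _).
- by move=> i j e; apply/ffunP => l; rewrite !ffunE !delcU setUC.
- move=> i q e iq /forallP eq; apply/forallP => j; rewrite ffunE.
  by rewrite -(setU1K iq); apply: lifts_delc; rewrite ?sub1set ?setU11.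
Defined.

Definition pushf (J K : finType) (h : J -> K) (v : {ffun J -> rat^o}) : {ffun K -> rat^o} :=
  [ffun y => \sum_(x | h x == y) v x].
Fact pushf_is_linear (J K : finType) h : linear (@pushf J K h).
Proof.
move=> a v w; apply/ffunP => y; rewrite !ffunE scaler_sumr -big_split.
by apply: eq_bigr => x _; rewrite !ffunE.
Qed.
HB.instance Definition _ (J K : finType) h := GRing.isLinear.Build rat _ _ _ (@pushf J K h) (@pushf_is_linear J K h).

Lemma pushf_comp (J K M : finType) (h : J -> K) (g : K -> M) v :
  pushf g (pushf h v) = pushf (g \o h) v.
Proof.
apply/ffunP => y; rewrite !ffunE (partition_big h (fun x => g x == y)) //=.
apply: eq_bigr => x /eqP gx; rewrite ffunE; apply: eq_bigl => z.
by case: eqP => [->|]; rewrite ?andbF // gx eqxx.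
Qed.

Lemma eq_pushf (J K : finType) (h g : J -> K) v : h =1 g -> pushf h v = pushf g v.
Proof. by move=> hg; apply/ffunP => y; rewrite !ffunE; apply: eq_bigl => x; rewrite hg. Qed.

Definition liftmod : cmod I.
refine (@Cmod I {ffun {set W} -> rat^o} (fun S => linfun (pushf (delc S)))
  (fun q => supported (mem (lifts q))) (fun _ => 0%VS) _ _ _ _ _).
- move=> v; rewrite lfunE; apply/ffunP => s; rewrite ffunE (big_pred1 s) // => t.
  by rewrite /delc preimset0 setD0.
- by move=> S S' v; rewrite !lfunE [LHS]pushf_comp; apply: eq_pushf => s; apply: delcU.
- move=> S q v Sq /supportedP vq; apply/supportedP => s sq; rewrite lfunE ffunE.
  apply: big1 => t /eqP st; apply: vq; apply: contra sq => tq.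
  by rewrite -st; apply: lifts_delc.
- by move=> S q v _; rewrite !memv0 => /eqP->; rewrite linear0.
- by move=> q; rewrite sub0v.
Defined.

Definition consf k (s : {set W}) (e : {ffun 'I_k -> {set W}}) : {ffun 'I_k.+1 -> {set W}} :=
  [ffun j => oapp e s (unlift ord0 j)].
Definition tailf k (e : {ffun 'I_k.+1 -> {set W}}) : {ffun 'I_k -> {set W}} :=
  [ffun j => e (lift ord0 j)].

Lemma consf0 k s (e : {ffun 'I_k -> {set W}}) : consf s e ord0 = s.
Proof. by rewrite ffunE unlift_none. Qed.
Lemma consfS k s (e : {ffun 'I_k -> {set W}}) j : consf s e (lift ord0 j) = e j.
Proof. by rewrite ffunE liftK. Qed.
Lemma tail_consf k s (e : {ffun 'I_k -> {set W}}) : tailf (consf s e) = e.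
Proof. by apply/ffunP => j; rewrite ffunE consfS. Qed.
Lemma consfK k (e : {ffun 'I_k.+1 -> {set W}}) : consf (e ord0) (tailf e) = e.
Proof.
by apply/ffunP => j; rewrite ffunE; case: unliftP => [l|] -> /=; rewrite ?ffunE.
Qed.

Lemma face_consf k q s (e : {ffun 'I_k -> {set W}}) :
  cface (c := tuples k.+1) q (consf s e) = (s \in lifts q) && cface (c := tuples k) q e.
Proof.
apply/forallP/andP => [h|[sq /forallP eq] j].
  split; first by rewrite -[s](consf0 s e).
  by apply/forallP => j; rewrite -(consfS s e j).
by rewrite ffunE; case: unliftP => [l|] _ /=.
Qed.
End Lifts.

(** * Leray bound for the tensor powers of the lifts *)

Section TupleLeray.
Variables (W I : finType) (c : W -> I) (X : {set {set W}}).
Hypothesis hX : is_complex X.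
Let Tk := tuples c hX.
Let A := liftmod c hX.

(** Currying the first entry of a tuple identifies the tensor power [k.+1] with [A] tensored with
    the power [k]; [joinc] is the inverse. *)
Definition splitc k (z : {ffun {set I} -> {ffun cel (Tk k.+1) -> rat^o}}) :
    {ffun {set I} -> {ffun cel (Tk k) -> csp A}} :=
  [ffun q => [ffun e => [ffun s => z q (consf s e)]]].
Definition joinc k (w : {ffun {set I} -> {ffun cel (Tk k) -> csp A}}) :
    {ffun {set I} -> {ffun cel (Tk k.+1) -> rat^o}} :=
  [ffun q => [ffun e => (w q (tailf e) : {ffun {set W} -> rat^o}) (e ord0)]].

Lemma splitcE k (z : {ffun {set I} -> {ffun cel (Tk k.+1) -> rat^o}}) q e s :
  (splitc z q e : {ffun {set W} -> rat^o}) s = z q (consf s e).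
Proof. by rewrite ffunE ffunE ffunE. Qed.
Lemma joincE k (w : {ffun {set I} -> {ffun cel (Tk k) -> csp A}}) q e :
  joinc w q e = (w q (tailf e) : {ffun {set W} -> rat^o}) (e ord0).
Proof. by rewrite ffunE ffunE. Qed.

Lemma joincK k : cancel (@joinc k) (@splitc k).
Proof.
move=> w; apply/ffunP => q; apply/ffunP => e; apply/ffunP => s.
by rewrite splitcE joincE tail_consf consf0.
Qed.

Lemma splitcK k : cancel (@splitc k) (@joinc k).
Proof. by move=> z; apply/ffunP => q; apply/ffunP => e; rewrite joincE splitcE consfK. Qed.

Lemma sum_csp (J : finType) (P : pred J) (F : J -> csp A) s :
  (\sum_(j | P j) F j : {ffun {set W} -> rat^o}) s =
  \sum_(j | P j) (F j : {ffun {set W} -> rat^o}) s.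
Proof. exact: sum_ffunE. Qed.

Lemma bd_splitc k z : tens_bd A (Tk k) (splitc z) = splitc (tens_bd (const_cmod I rat^o) (Tk k.+1) z).
Proof.
apply/ffunP => q; apply/ffunP => e; apply/ffunP => s.
rewrite splitcE.
rewrite /tens_bd !bdE !sum_ffunE; apply: eq_bigr => i iq.
rewrite !ffunE sum_csp; congr (_ * _).
transitivity (\sum_(x : cel (Tk k) | cdel i x == e) \sum_(t | delc c [set i] t == s) z (i |: q) (consf t x)).
  apply: eq_bigr => x _; rewrite lfunE ffunE; by apply: eq_bigr => t _; rewrite ffunE ffunE.
rewrite pair_big /= (reindex (fun y : cel (Tk k.+1) => (tailf y, y ord0))) /=; last first.
  exists (fun p => consf p.2 p.1) => [y _|[x t] _] /=; first exact: consfK.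
  by rewrite tail_consf consf0.
apply: eq_big => [y|y _]; last by rewrite consfK id_lfunE.
apply/andP/eqP => [[/eqP ye /eqP y0]|ye].
  apply/ffunP => j; rewrite !ffunE; case: unliftP => [l|] -> //=.
  by move/ffunP/(_ l): ye; rewrite !ffunE.
split; first by apply/eqP/ffunP => j; move/ffunP/(_ (lift ord0 j)): ye; rewrite !ffunE liftK.
by apply/eqP; move/ffunP/(_ ord0): ye; rewrite !ffunE unlift_none.
Qed.

(** The empty tuple gives a full simplex, and each further factor adds [L] by [tensor_leray]. *)
Lemma tuples_leray L k : tleray A (unit_cset I) L -> tleray (const_cmod I rat^o) (Tk k) (k * L).
Proof.
move=> hA; elim: k => [|k IHk].
  apply: simplex_leray => [i e|q e]; first by apply/ffunP => -[].
  by apply/forallP => -[].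
move=> T n Ln z zT Mz dz; rewrite mulSn in Ln.
have hT := tensor_leray hA (fun Z => leray_coef (Z := Z) IHk) Ln.
have dz0 : tens_bd (const_cmod I rat^o) (Tk k.+1) z = 0.
  apply/ffunP => q; apply/ffunP => e; rewrite [RHS](_ : _ = 0); last by rewrite !ffunE.
  by have := dz q e; case: ifP => // _ h; apply/eqP; rewrite -memv0.
have [|q e|q|w [wT Mw zw]] := hT T (splitc z).
- move=> q qT; apply/ffunP => e; apply/ffunP => s.
  by rewrite splitcE zT // !ffunE.
- case: ifP => eq.
    apply/supportedP => s sq; have {}sq : s \notin lifts c X q := sq; rewrite splitcE; have := Mz q (consf s e).
    by rewrite face_consf (negPf sq).
  apply/ffunP => s; rewrite splitcE [RHS]ffunE; have := Mz q (consf s e).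
  by rewrite face_consf eq andbF.
- rewrite -[bd _ _]/(tens_bd A (Tk k) (splitc z)) bd_splitc dz0 => e.
  rewrite (_ : splitc _ q e = 0); last by apply/ffunP => s; rewrite splitcE !ffunE.
  by case: ifP => // _; apply: mem0v.
exists (joinc w); split.
- by move=> q qT; apply/ffunP => e; rewrite joincE wT // !ffunE.
- move=> q e; rewrite joincE -{1}(consfK e) face_consf.
  have := Mw q (tailf e); case: ifP => eq; last by move=> ->; rewrite andbF ffunE.
  by rewrite andbT => /supportedP we; case: ifP => [_|/negbT /we] //; apply: memvf.
suff -> : z = tens_bd (const_cmod I rat^o) (Tk k.+1) (joinc w).
  by move=> q e; rewrite subrr !ffunE; case: ifP => // _; apply: mem0v.
apply: (can_inj (@splitcK k)); rewrite -bd_splitc joincK.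
apply/ffunP => q; apply/ffunP => e; apply/eqP; rewrite -subr_eq0.
have ffB (x y : {ffun cel (Tk k) -> csp A}) : (x - y) e = x e - y e by rewrite !ffunE.
have := zw q e; rewrite ffB -[bd _ _]/(tens_bd A (Tk k) w).
by case: ifP => [_ h|_ ->] //; rewrite -memv0.
Qed.

End TupleLeray.

(** * The Leray number of [X] in terms of colours *)

Section Orientation.
Variables (W I : finType) (c : W -> I) (X : {set {set W}}).
Hypothesis hX : is_complex X.
Hypothesis hcol : forall s, s \in X -> {in s &, injective c}.
Let A := liftmod c hX.

Lemma sg_prod (T : finType) (i : T) (q : {set T}) :
  sg i q = \prod_(j in q) (if (enum_rank j < enum_rank i)%N then -1 else 1).
Proof.
rewrite -big_mkcondr /= /sg -prodr_const; apply: eq_bigl => j; by rewrite !inE.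
Qed.

(* [orient s] is the sign comparing the order of the vertices of [s] with the
   order of their colours. *)
Definition disag (u v : W) : rat :=
  if (enum_rank u < enum_rank v)%N && (enum_rank (c v) < enum_rank (c u))%N then -1 else 1.

Definition orient (s : {set W}) : rat := \prod_(u in s) \prod_(v in s) disag u v.

Lemma orient_sq s : orient s * orient s = 1.
Proof.
rewrite -big_split big1 //= => u _; rewrite -big_split big1 //= => v _.
by rewrite /disag; case: ifP; rewrite ?mulrNN ?mulr1.
Qed.

(** Only the pairs formed by [v] and some [u] in [s] are new; each contributes -1 exactly when the
    vertex order and the colour order disagree on it. *)
Lemma orientU v (s : {set W}) : v \notin s -> {in v |: s &, injective c} ->
  orient (v |: s) = orient s * (sg v s * sg (c v) (c @: s)).
Proof.
move=> vs cinj; have cinj_s : {in s &, injective c}.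
  by move=> x y xs ys; apply: cinj; rewrite inE ?xs ?ys orbT.
rewrite !sg_prod (big_imset _ cinj_s) /=.
have -> : orient (v |: s) =
    orient s * (\prod_(u in s) disag v u * \prod_(u in s) disag u v).
  rewrite /orient big_setU1 //= big_setU1 //= {1}/disag ltnn mul1r [RHS]mulrCA; congr (_ * _).
  by rewrite -big_split; apply: eq_bigr => u _; rewrite big_setU1 //= mulrC.
congr (_ * _); rewrite -!big_split /=.
apply: eq_bigr => u us; rewrite /disag.
have uv : u != v by apply: contraNneq vs => <-.
have cuv : c u != c v.
  by apply: contra uv => /eqP cuv; apply/eqP/cinj; rewrite // !inE ?eqxx ?us ?orbT.
have : enum_rank u != enum_rank v :> nat by rewrite (inj_eq val_inj) (inj_eq enum_rank_inj).
have : enum_rank (c u) != enum_rank (c v) :> nat by rewrite (inj_eq val_inj) (inj_eq enum_rank_inj).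
case: (ltngtP (enum_rank (c u)) (enum_rank (c v))) => // _ _.
all: by case: (ltngtP (enum_rank u) (enum_rank v)).
Qed.

(** The factor [orient s] passes from signs given by the order of colours to signs given by the
    order of vertices. *)
Definition flat (z : {ffun {set I} -> {ffun cel (unit_cset I) -> csp A}}) : {ffun {set W} -> rat^o} :=
  [ffun s => orient s * (z (c @: s) tt : {ffun {set W} -> rat^o}) s].

Lemma flatE (z : {ffun {set I} -> {ffun cel (unit_cset I) -> csp A}}) s : flat z s = orient s * (z (c @: s) tt : {ffun {set W} -> rat^o}) s.
Proof. by rewrite ffunE. Qed.

Lemma mem_liftsP q s : reflect (s \in X /\ c @: s = q) (s \in lifts c X q).
Proof. by rewrite inE; apply: (iffP andP) => -[sX /eqP]. Qed.

Lemma bd_flat (z : {ffun {set I} -> {ffun cel (unit_cset I) -> csp A}}) s : (forall q, tens_in (ctop A) (unit_cset I) q (z q)) ->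
  simplicial_bd (flat z) s = orient s * (tens_bd A (unit_cset I) z (c @: s) tt : {ffun {set W} -> rat^o}) s.
Proof.
move=> Mz; set q := c @: s.
have z0 p t : t \notin lifts c X p -> (z p tt : {ffun {set W} -> rat^o}) t = 0.
  by move=> tp; have /supportedP := Mz p tt; apply.
rewrite simplicial_bdE /tens_bd bdE !sum_ffunE mulr_sumr.
rewrite (partition_big c xpredT) //= [RHS]big_mkcond; apply: eq_bigr => i _.
have vX v : v \notin s -> v |: s \in X -> c v \notin q.
  move=> vs vsX; apply: contra vs => /imsetP[u us cuv].
  have -> // : v = u by apply: (hcol vsX) => //; rewrite ?setU11 // setU1r.
(* If the colour [i] already occurs in [s], adding another vertex of that colour leaves [X]. *)
case: ifP => [iq|/negbT/negPn iq]; last first.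
  rewrite big1 // => v /andP[vs /eqP vi]; rewrite flatE z0 ?mulr0 //.
  by apply/mem_liftsP => -[/vX]; rewrite vi iq => /(_ vs).
rewrite !ffunE sum_csp (big_pred1 tt) => [|[]//]; rewrite lfunE ffunE.
set h := (z (i |: q) tt : {ffun {set W} -> rat^o}).
have siq (v : W) : c v = i -> v \notin s by move=> vi; apply: contra iq => vs; rewrite -vi imset_f.
transitivity (\sum_(v | c v == i) orient s * (sg i q * h (v |: s))).
  apply: eq_big => [v|v /andP[vs /eqP vi]].
    by case: eqP => [/siq->|]; rewrite ?andbF.
  rewrite flatE imsetU1 vi -/q -/h.
  have [/mem_liftsP[vsX _]|vX'] := boolP ((v |: s) \in lifts c X (i |: q)).
    rewrite orientU //; last exact: hcol.
    by rewrite vi -!mulrA [LHS]mulrCA [sg v s * (sg v s * _)]mulrA sg_sq mul1r.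
  by rewrite /h z0 ?mulr0.
rewrite -mulr_sumr; congr (_ * _); rewrite -[RHS]/(sg i q * _) -mulr_sumr; congr (_ * _).
have inj : {in [set v | c v == i] &, injective (fun v => v |: s)}.
  move=> u v; rewrite !inE => /eqP/siq us /eqP _ /setP/(_ u).
  by rewrite !inE eqxx (negPf us) /= orbF => /esym/eqP.
transitivity (\sum_(t in [set v |: s | v in [set v | c v == i]]) h t).
  by rewrite big_imset //=; apply: eq_bigl => v; rewrite inE.
(* A lift [t] of [i |: q] that becomes [s] after deleting [i] has exactly one vertex of colour [i],
   so it is some [v |: s]; on any other [t] the value is zero. *)
rewrite [LHS]big_mkcond [RHS]big_mkcond; apply: eq_bigr => t _ /=.
have delE v : c v = i -> delc c [set i] (v |: s) = s.
  move=> vi; apply/setP => u; rewrite !inE; case: (eqVneq u v) => [->|_] /=.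
    by rewrite vi eqxx (negPf (siq v vi)).
  by case: eqP => // /siq/negPf.
case: ifP => [/imsetP[v]|tI].
  by rewrite inE => /eqP vi ->; rewrite delE ?eqxx.
case: ifP => // /eqP ts; rewrite /h z0 //; apply/mem_liftsP => -[tX tq].
have /imsetP[v vt vi] : i \in c @: t by rewrite tq setU11.
case/imsetP: tI; exists v; rewrite ?inE -?vi //.
apply/setP => u; rewrite -ts !inE; case: (eqVneq u v) => [->|uv] //=.
case ut: (u \in t); rewrite ?andbF // andbT vi; apply/esym/eqP => /(hcol tX ut vt).
by apply/eqP.
Qed.

(** Restricting to subsets of [T] amounts to inducing [X] on the vertices with colour in [T]; sizes
    agree because [c] is injective on simplices. *)
Lemma liftmod_leray L :
  (forall (T : {set I}) n, (L < n)%N -> complex_exact (induced X (c @^-1: T)) n) -> tleray A (unit_cset I) L.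
Proof.
move=> hL T n Ln z zT Mz dz.
have z0 p t : t \notin lifts c X p -> (z p tt : {ffun {set W} -> rat^o}) t = 0.
  by move=> tp; have /supportedP := Mz p tt; apply.
have cards (s : {set W}) : s \in X -> #|c @: s| = #|s| by move=> /hcol; apply: card_in_imset.
have flat0 s : s \notin X -> flat z s = 0.
  by move=> sX; rewrite flatE z0 ?mulr0 //; apply/mem_liftsP => -[/(negP sX)].
have flatT (s : {set W}) : ~~ ((c @: s \subset T) && (#|c @: s| == n)) -> flat z s = 0.
  by move=> sT; rewrite flatE zT // !ffunE mulr0.
have dz0 : tens_bd A (unit_cset I) z = 0.
  apply/ffunP => q; apply/ffunP => e; rewrite [RHS](_ : _ = 0); last by rewrite !ffunE.
  by have := dz q e => /= h; apply/eqP; rewrite -memv0.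
have [s sn|s|s|g [gT gK fg]] := hL T n Ln (flat z).
- have [sX|/flat0 //] := boolP (s \in X).
  by apply: flatT; rewrite cards //; apply: contra sn => /andP[_ ->]; rewrite subsetT.
- rewrite /in_complex !inE; have [sX|/flat0->] := boolP (s \in X); last by rewrite eqxx orbT.
  have [sT|sT] := boolP (c @: s \subset T).
    by rewrite -sub_imset_pre sT.
  by rewrite flatT ?eqxx ?orbT // (negPf sT).
- by rewrite -[bd _ _]/(simplicial_bd (flat z)) bd_flat // dz0 !ffunE mulr0.
have g0 s : s \notin induced X (c @^-1: T) -> g s = 0.
  by move=> /negPf sK; have := gK s; rewrite /in_complex sK => /eqP.
pose w : {ffun {set I} -> {ffun cel (unit_cset I) -> csp A}} :=
  [ffun q => [ffun => [ffun s => if s \in lifts c X q then orient s * g s else 0]]].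
have Mw q : tens_in (ctop A) (unit_cset I) q (w q).
  by move=> e; apply/supportedP => s /negPf sq; rewrite !ffunE; move: sq => /= ->.
have fw : flat w = g.
  apply/ffunP => s; rewrite flatE !ffunE; case: ifP => [_|/mem_liftsP sX].
    by rewrite mulrA orient_sq mul1r.
  rewrite mulr0 g0 // inE; apply/negP => /andP[sX' _]; exact: sX.
exists w; split=> // [q qT|q e].
  apply/ffunP => e; apply/ffunP => s; rewrite !ffunE; case: ifP => // /mem_liftsP[sX sq].
  have [sK|/g0->] := boolP (s \in induced X (c @^-1: T)); last by rewrite mulr0.
  rewrite gT ?mulr0 // subsetT; apply: contra qT => /andP[_ sn].
  by rewrite -sq cards // sn andbT sub_imset_pre; move: sK; rewrite inE => /andP[].
have Mw' := bd_in (tens_in_submod _ (unit_cset I)) (@tens_stab I A (unit_cset I) _ (@cop_top I A)) Mw.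
suff -> : z q = tens_bd A (unit_cset I) w q by rewrite subrr ffunE; apply: mem0v.
apply/ffunP => -[]; apply/ffunP => s.
have [/mem_liftsP[sX sq]|sq] := boolP (s \in lifts c X q); last first.
  rewrite z0 //; have /supportedP/(_ s) := Mw' q tt; by move=> ->.
have := subr0_eq (fg s); rewrite -[bd _ _]/(simplicial_bd g) -{1}fw bd_flat // flatE sq.
by move/(congr1 (fun x => orient s * x)); rewrite !mulrA orient_sq !mul1r.
Qed.
End Orientation.

(** * Alternating functions on tuples *)

Section Alternating.
Variable W : finType.
Local Notation tuple_ k := {ffun 'I_k -> {set W}}.
Local Notation tuple_fun k := {ffun {ffun 'I_k -> {set W}} -> rat^o}.

Definition permf k (p : 'S_k) (e : tuple_ k) : tuple_ k := [ffun j => e (p j)].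
(** The exterior power is modelled by antisymmetric tensors, a direct summand of the tensor power
    over the rationals by [antisym]. *)
Definition alternating k (v : tuple_fun k) := forall p e, v (permf p e) = (-1) ^+ p * v e.

Lemma permfM k (p p' : 'S_k) e : permf p (permf p' e) = permf (p * p')%g e.
Proof. by apply/ffunP => j; rewrite !ffunE permM. Qed.

Lemma permf1 k (e : tuple_ k) : permf 1%g e = e.
Proof. by apply/ffunP => j; rewrite ffunE perm1. Qed.

Lemma permf_inj k (p : 'S_k) : injective (permf p).
Proof.
by apply: (can_inj (g := permf p^-1%g)) => e; rewrite permfM mulVg permf1.
Qed.

Lemma alternating0 k : alternating (0 : tuple_fun k).
Proof. by move=> p e; rewrite !ffunE mulr0. Qed.

Lemma alternatingB k (v w : tuple_fun k) : alternating v -> alternating w -> alternating (v - w).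
Proof. by move=> av aw p e; rewrite !ffunE av aw mulrBr. Qed.

Lemma alternating_push k (h : tuple_ k -> tuple_ k) (v : tuple_fun k) :
  (forall p e, h (permf p e) = permf p (h e)) -> alternating v -> alternating (pushf h v).
Proof.
move=> hp av p e; rewrite !ffunE mulr_sumr (reindex_inj (@permf_inj k p)).
by apply: eq_big => [x|x _]; rewrite ?av // hp (inj_eq (@permf_inj k p)).
Qed.

Lemma alternating_sum k (J : finType) (P : pred J) (a : J -> rat) (F : J -> tuple_fun k) :
  (forall j, alternating (F j)) -> alternating (\sum_(j | P j) a j *: F j).
Proof.
move=> aF p e; rewrite !sum_ffunE mulr_sumr; apply: eq_bigr => j _.
by rewrite !ffunE aF; apply: mulrCA.
Qed.

Lemma tailf_permf k (p : 'S_k) (e : tuple_ k.+1) :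
  tailf (permf (lift_perm ord0 ord0 p) e) = permf p (tailf e).
Proof. by apply/ffunP => j; rewrite !ffunE lift_perm_lift. Qed.

(** Summing out the first entry is contraction with the functional equal to 1 on each basis vector,
    the Koszul differential on exterior powers. *)
Lemma alternating_tail k (v : tuple_fun k.+1) : alternating v -> alternating (pushf (@tailf W k) v).
Proof.
move=> av p e; rewrite !ffunE mulr_sumr (reindex_inj (@permf_inj _ (lift_perm ord0 ord0 p))).
apply: eq_big => [x|x _]; first by rewrite tailf_permf (inj_eq (@permf_inj k p)).
by rewrite av odd_lift_perm.
Qed.

(** Exchanging the first two entries changes the sign of [v] but not the remaining tuple. *)
Lemma tail_tail0 k (v : tuple_fun k.+2) : alternating v ->
  pushf (@tailf W k) (pushf (@tailf W k.+1) v) = 0.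
Proof.
move=> av; rewrite pushf_comp; apply/ffunP => e; rewrite [RHS]ffunE.
apply: opp_self0; rewrite {1}ffunE ffunE -sumrN.
pose p : 'S_k.+2 := tperm ord0 (lift ord0 ord0).
rewrite (reindex_inj (@permf_inj _ p)); apply: eq_big => [x|x _]; last first.
  by rewrite av odd_tperm /= expr1 mulN1r.
congr (_ == _); apply/ffunP => j; rewrite !ffunE tpermD //.
Qed.

Lemma alternating_eq0 k (v : tuple_fun k) (e : tuple_ k) (i j : 'I_k) : alternating v -> i != j -> e i = e j -> v e = 0.
Proof.
move=> av ij eij; apply: (@opp_self0 rat^o).
have -> : - v e = v (permf (tperm i j) e) by rewrite av odd_tperm ij expr1 mulN1r.
by congr (v _); apply/ffunP => l; rewrite ffunE; case: tpermP => [->|->|].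
Qed.

Lemma lift_permE n (p : 'S_n.+1) i : exists s, p = lift_perm i (p i) s.
Proof.
pose f j := odflt j (unlift (p i) (p (lift i j))).
have fE j : lift (p i) (f j) = p (lift i j).
  rewrite /f; case: unliftP => [l ->//|/perm_inj/eqP].
  by rewrite eq_sym (negPf (neq_lift _ _)).
have fI : injective f.
  by move=> j l /(congr1 (lift (p i))); rewrite !fE => /perm_inj/lift_inj.
exists (perm fI); apply/permP => j; case: (unliftP i j) => [l|] ->.
  by rewrite lift_perm_lift permE fE.
by rewrite lift_perm_id.
Qed.

Definition dropf k (i : 'I_k.+1) (e : tuple_ k.+1) : tuple_ k := [ffun j => e (lift i j)].

(* Wedge product with the basis vector [x], a contracting homotopy of
   [pushf (@tailf W _)]. *)
Definition conef k (x : {set W}) (v : tuple_fun k) : tuple_fun k.+1 :=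
  [ffun e : tuple_ k.+1 => \sum_(i < k.+1) (-1) ^+ i * (e i == x)%:R * v (dropf i e)].

Lemma alternating_cone k x (v : tuple_fun k) : alternating v -> alternating (conef x v).
Proof.
move=> av p e; rewrite !ffunE [in RHS](reindex_inj (@perm_inj _ p)) mulr_sumr.
apply: eq_bigr => i _; have [s ps] := lift_permE p i.
have -> : dropf i (permf p e) = permf s (dropf (p i) e).
  by apply/ffunP => j; rewrite !ffunE {1}ps lift_perm_lift.
have pE : (-1) ^+ p = (-1) ^+ i * (-1) ^+ p i * (-1) ^+ s :> rat.
  by rewrite {1}ps odd_lift_perm !signr_addb !signr_odd.
have sq : (-1) ^+ p i * (-1) ^+ p i = 1 :> rat by rewrite -exprD addnn -mul2n exprM sqrrN !expr1n.
rewrite ffunE av pE -[LHS](mulr1 (_ : rat)) -[X in _ * X = _]sq.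
have aux (a b d f y : rat) : a * b * (d * y) * (f * f) = a * f * d * (f * b * y) by ring.
exact: aux.
Qed.

Lemma pushf_tailE k (v : tuple_fun k.+1) e : pushf (@tailf W k) v e = \sum_g v (consf g e).
Proof.
rewrite ffunE (reindex (fun g => consf g e)); last first.
  exists (fun s : tuple_ k.+1 => s ord0) => [g _|s]; first exact: consf0.
  by rewrite inE => /eqP <-; rewrite consfK.
by apply: eq_bigl => g; rewrite tail_consf eqxx.
Qed.

(** The Koszul complex ends in row [0], where every element counts as a cycle. *)
Definition tcycle k : tuple_fun k -> Prop :=
  match k return tuple_fun k -> Prop with 0 => fun=> True | k'.+1 => fun v => pushf (@tailf W k') v = 0 end.

(** The term with [x] in first position gives back [v]; each other term contains a contraction of
    [v], which is zero. *)
Lemma tail_cone k x (v : tuple_fun k) : tcycle v -> pushf (@tailf W k) (conef x v) = v.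
Proof.
move=> cv; apply/ffunP => e; rewrite pushf_tailE.
under eq_bigr do rewrite ffunE big_ord_recl expr0 mul1r consf0.
rewrite big_split /= (bigD1 x) //= eqxx mul1r big1 => [|g /negPf->]; last by rewrite mul0r.
rewrite addr0 (_ : dropf ord0 (consf x e) = e); last exact: tail_consf.
rewrite exchange_big big1 ?addr0 //= => i _.
case: k v cv e i => [|k] v cv e i; first by case: i.
under eq_bigr do rewrite consfS.
rewrite -mulr_sumr; suff -> : \sum_g v (dropf (lift ord0 i) (consf g e)) = 0 by rewrite mulr0.
have /ffunP/(_ (dropf i e)) := cv; rewrite pushf_tailE [RHS]ffunE => h; apply: etrans h.
apply: eq_bigr => g _; congr (v _); apply/ffunP => j; rewrite !ffunE.
case: (unliftP ord0 j) => [l|] -> /=.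
  have -> : lift (lift ord0 i) (lift ord0 l) = lift ord0 (lift i l).
    by apply: val_inj; rewrite /= /bump !leq0n !add1n ltnS addnS.
  by rewrite liftK ffunE.
have -> : lift (lift ord0 i) ord0 = ord0 by apply: val_inj.
by rewrite unlift_none.
Qed.

Definition antisym k (v : tuple_fun k) : tuple_fun k :=
  (k`!%:R)^-1 *: \sum_(p : 'S_k) (-1) ^+ p *: pushf (permf p) v.

Lemma antisym_linear k : linear (@antisym k).
Proof.
move=> a v w; rewrite /antisym scalerA [a * _]mulrC -scalerA -scalerDr; congr (_ *: _).
rewrite scaler_sumr -big_split; apply: eq_bigr => p _.
by rewrite linearP scalerDr !scalerA mulrC.
Qed.
HB.instance Definition _ k := GRing.isLinear.Build rat _ _ _ (@antisym k) (@antisym_linear k).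

Lemma pushf_permf k (p : 'S_k) (v : tuple_fun k) e : pushf (permf p) v e = v (permf p^-1%g e).
Proof.
rewrite ffunE (big_pred1 (permf p^-1%g e)) // => x /=.
by rewrite -(inj_eq (@permf_inj k p^-1%g)) permfM mulVg permf1.
Qed.

Lemma antisymE k (v : tuple_fun k) e :
  antisym v e = (k`!%:R)^-1 * \sum_(p : 'S_k) (-1) ^+ p * v (permf p^-1%g e) :> rat.
Proof.
rewrite ffunE sum_ffunE; congr (_ * _); apply: eq_bigr => p _.
by rewrite ffunE pushf_permf.
Qed.

Lemma antisym_alternating k (v : tuple_fun k) : alternating (antisym v).
Proof.
move=> p e; rewrite !antisymE [RHS]mulrCA; congr (_ * _); rewrite mulr_sumr.
rewrite (reindex_inj (mulgI p)) /=; apply: eq_bigr => s _.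
by rewrite permfM invMg mulgKV odd_permM signr_addb mulrA.
Qed.

Lemma antisym_id k (v : tuple_fun k) : alternating v -> antisym v = v.
Proof.
move=> av; apply/ffunP => e; rewrite antisymE (eq_bigr (fun=> v e)) => [|p _].
  have mulK (x : rat) : (k`!%:R)^-1 * (x *+ k`!) = x.
    by rewrite -[x *+ _]mulr_natl mulKf // pnatr_eq0 -lt0n fact_gt0.
  by rewrite sumr_const card_Sn; apply: mulK.
by rewrite av odd_permV mulrA -signr_addb addbb expr0 mul1r.
Qed.

Lemma antisym_push k (h : tuple_ k -> tuple_ k) (v : tuple_fun k) :
  (forall p e, h (permf p e) = permf p (h e)) -> pushf h (antisym v) = antisym (pushf h v).
Proof.
move=> hp; rewrite /antisym linearZ linear_sum; congr (_ *: _); apply: eq_bigr => p _.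
rewrite linearZ /= !pushf_comp; congr (_ *: _); apply: eq_pushf => e; exact: hp.
Qed.
End Alternating.

(** * The double complex of alternating chains *)

Section Descent.
Variables (W I : finType) (c : W -> I) (X : {set {set W}}).
Hypothesis hX : is_complex X.
Let Tk := tuples c hX.
Local Notation tuple_chain k := {ffun {set I} -> {ffun {ffun 'I_k -> {set W}} -> rat^o}}.

Definition tuple_bd k (z : tuple_chain k) : tuple_chain k := tens_bd (const_cmod I rat^o) (Tk k) z.

(** [alt_void] makes row [0] the chain complex of the image complex, since the empty tuple is a face
    of every [q]. *)
Record alt_chain k (T : {set I}) n (z : tuple_chain k) : Prop := AltChain {
  alt_supp : supp T n z;
  alt_face : forall q e, ~~ cface (c := Tk k) q e -> z q e = 0;
  alt_void : forall q, lifts c X q = set0 -> z q = 0;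
  alt_alternating : forall q, alternating (z q) }.

Lemma tuple_bdE k (z : tuple_chain k) q :
  tuple_bd z q = \sum_(i | i \notin q) sg i q *: pushf (cdel (c := Tk k) i) (z (i |: q)).
Proof.
rewrite /tuple_bd /tens_bd bdE; apply: eq_bigr => i _; congr (_ *: _).
by apply/ffunP => e; rewrite !ffunE; apply: eq_bigr => x _; rewrite id_lfunE.
Qed.

Lemma tuple_bdB k (z w : tuple_chain k) : tuple_bd (z - w) = tuple_bd z - tuple_bd w.
Proof. exact: bdB. Qed.

Lemma tuple_bd_bd k (z : tuple_chain k) : tuple_bd (tuple_bd z) = 0.
Proof. exact: (bd_bd _ (@tensC I (const_cmod I rat^o) (Tk k))). Qed.

Lemma cdel_permf k i p (e : {ffun 'I_k -> {set W}}) :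
  cdel (c := Tk k) i (permf p e) = permf p (cdel (c := Tk k) i e).
Proof. by apply/ffunP => j; rewrite !ffunE. Qed.

Lemma lifts0_sub q i : lifts c X q = set0 -> i \notin q -> lifts c X (i |: q) = set0.
Proof.
move=> q0 iq; apply/eqP; rewrite -subset0; apply/subsetP => s sq.
have := @lifts_delc W I c X hX [set i] _ s _ sq.
by rewrite sub1set setU11 setU1K // q0 !inE; apply.
Qed.

Lemma alt_chain_bd k T n (z : tuple_chain k) : alt_chain T n.+1 z -> alt_chain T n (tuple_bd z).
Proof.
case=> zT zF zV zA; split.
- exact: supp_bd.
- move=> q e qe; rewrite tuple_bdE sum_ffunE big1 // => i iq; rewrite !ffunE big1 ?scaler0 // => x /eqP xe.
  by rewrite zF //; apply: contra qe => /(cface_del iq); rewrite xe.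
- by move=> q q0; rewrite tuple_bdE big1 // => i iq; rewrite zV ?linear0 ?scaler0 // lifts0_sub.
- move=> q; rewrite tuple_bdE; apply: alternating_sum => i.
  by apply: alternating_push => // p e; apply: cdel_permf.
Qed.

Lemma alt_chainB k T n (z w : tuple_chain k) : alt_chain T n z -> alt_chain T n w -> alt_chain T n (z - w).
Proof.
case=> zT zF zV zA [wT wF wV wA]; split.
- exact: supp_sub.
- by move=> q e qe; rewrite !ffunE zF ?wF // subrr.
- by move=> q q0; rewrite chainB zV ?wV // subrr.
- by move=> q; rewrite chainB; apply: alternatingB.
Qed.

Lemma alt_chain0 k T n : alt_chain T n (0 : tuple_chain k).
Proof.
split=> [q _|q e _|q _|q]; rewrite ?ffunE //; exact: alternating0.
Qed.

(** A bounding chain in the tensor power is made alternating by [antisym], which commutes with the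
    boundary and fixes [z]. A nonempty tuple exhibits a lift of [q], which gives [alt_void]. *)
Lemma alt_chain_exact k T n L (z : tuple_chain k.+1) : tleray (const_cmod I rat^o) (Tk k.+1) L -> (L < n)%N ->
  alt_chain T n z -> tuple_bd z = 0 -> exists2 u, alt_chain T n.+1 u & z = tuple_bd u.
Proof.
move=> hL Ln [zT zF zV zA] dz.
have [q e|q|u [uT Mu zu]] := hL T n Ln z zT.
- by case: ifPn => [_|/zF //]; apply: memvf.
- rewrite -[bd _ _]/(tuple_bd z) dz ffunE => e; rewrite ffunE; case: ifP => // _; exact: mem0v.
have {}zu : z = tuple_bd u.
  apply/ffunP => q; apply/ffunP => e; apply/eqP; rewrite -subr_eq0.
  have := zu q e; rewrite -[bd _ _]/(tuple_bd u).
  have -> : (z q - tuple_bd u q : {ffun _ -> rat^o}) e = z q e - tuple_bd u q e by rewrite !ffunE.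
  by case: ifP => [_ h|_ ->] //; rewrite -memv0.
have uF q e : ~~ cface (c := Tk k.+1) q e -> u q e = 0.
  by move=> qe; have := Mu q e; rewrite (negPf qe).
pose w : tuple_chain k.+1 := [ffun q => antisym (u q)].
have wF q e : ~~ cface (c := Tk k.+1) q e -> w q e = 0.
  move=> qe; rewrite ffunE antisymE big1 ?mulr0 // => p _; rewrite uF ?mulr0 //.
  apply: contra qe => /forallP qe; apply/forallP => j.
  by have := qe (p j); rewrite ffunE permK.
exists w; first split=> //.
- by move=> q qT; rewrite ffunE uT // linear0.
- move=> q q0; apply/ffunP => e; rewrite [RHS]ffunE; apply: wF.
  by apply/forallP => /(_ ord0); rewrite q0 inE.
- by move=> q; rewrite ffunE; apply: antisym_alternating.
apply/ffunP => q; rewrite -(antisym_id (zA q)) zu !tuple_bdE linear_sum /=.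
apply: eq_bigr => i _; rewrite linearZ /= ffunE antisym_push // => p e.
exact: cdel_permf.
Qed.

Definition tail_chain k (z : tuple_chain k.+1) : tuple_chain k := [ffun q => pushf (@tailf W k) (z q)].

Lemma tail_chainB k (z w : tuple_chain k.+1) : tail_chain (z - w) = tail_chain z - tail_chain w.
Proof. by apply/ffunP => q; rewrite ffunE !chainB linearB !ffunE. Qed.

Lemma tuple_bd_tail k (z : tuple_chain k.+1) : tuple_bd (tail_chain z) = tail_chain (tuple_bd z).
Proof.
apply/ffunP => q; rewrite [RHS]ffunE !tuple_bdE linear_sum /=; apply: eq_bigr => i _.
rewrite linearZ /= ffunE !pushf_comp; congr (_ *: _).
by apply: eq_pushf => e; apply/ffunP => j; rewrite !ffunE.
Qed.

Lemma alt_chain_tail k T n (z : tuple_chain k.+1) : alt_chain T n z -> alt_chain T n (tail_chain z).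
Proof.
case=> zT zF zV zA; split.
- by move=> q qT; rewrite ffunE zT // linear0.
- move=> q e qe; rewrite ffunE pushf_tailE big1 // => g _; rewrite zF //.
  by rewrite face_consf negb_and qe orbT.
- by move=> q q0; rewrite ffunE zV // linear0.
- by move=> q; rewrite ffunE; apply: alternating_tail.
Qed.

(** The columns are exact: cone with a chosen lift of [q], and use [alt_void] where [q] has none. *)
Lemma alt_chain_cone k T n (z : tuple_chain k) : alt_chain T n z -> (forall q, tcycle (z q)) ->
  exists2 w, alt_chain T n w & tail_chain w = z.
Proof.
case=> zT zF zV zA zC.
pose w : tuple_chain k.+1 := [ffun q => if [pick x in lifts c X q] is Some x then conef x (z q) else 0].
exists w; first split.
- move=> q qT; rewrite ffunE zT //; case: pickP => // x _.
  by apply/ffunP => e; rewrite !ffunE big1 // => i _; rewrite ffunE mulr0.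
- move=> q e qe; rewrite ffunE; case: pickP => [x xq|_]; rewrite ffunE // big1 // => i _.
  case: eqP => [ei|_]; last by rewrite mulr0 mul0r.
  rewrite zF ?mulr0 //; apply: contra qe => /forallP qe; apply/forallP => j.
  case: (unliftP i j) => [l|] ->; last by rewrite ei.
  by have := qe l; rewrite ffunE.
- by move=> q q0; rewrite ffunE; case: pickP => // x; rewrite q0 inE.
- move=> q; rewrite ffunE; case: pickP => [x _|_]; last exact: alternating0.
  exact: alternating_cone.
apply/ffunP => q; rewrite !ffunE; case: pickP => [x _|q0]; first exact: tail_cone.
rewrite linear0 zV //; apply/setP => x; rewrite in_set0; exact: q0.
Qed.

Variable r : nat.
Hypothesis hr : forall q, (#|lifts c X q| <= r)%N.

(** Pigeonhole: a tuple of [r.+1] lifts of [q] repeats an entry. *)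
Lemma alt_chain_eq0 T n (z : tuple_chain r.+1) : alt_chain T n z -> z = 0.
Proof.
case=> _ zF _ zA; apply/ffunP => q; apply/ffunP => e; rewrite [RHS](_ : _ = 0); last by rewrite !ffunE.
have [/forallP qe|/zF //] := boolP (cface (c := Tk r.+1) q e).
have [/injectiveP einj|/injectivePn[i [j ij eij]]] := boolP (injectiveb e).
  have : (#|[set e j | j : 'I_r.+1]| <= #|lifts c X q|)%N.
    by apply/subset_leq_card/subsetP => s /imsetP[j _ ->]; apply: qe.
  by rewrite card_imset // card_ord => /leq_trans/(_ (hr q)); rewrite ltnn.
exact: alternating_eq0 ij eij.
Qed.

Variable L : nat.
Hypothesis hL : tleray (liftmod c hX) (unit_cset I) L.

(* [z] is the image of a chain [w] of row [k.+1]. By the case [k.+1] the boundary of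
   [w] bounds a [v] which dies in row [k], so [w - v] is a cycle of row [k.+1], and
   that row is exact in this size. *)
Lemma alt_chain_descent k T n (z : tuple_chain k) : (k <= r)%N -> (r * L + r <= n + k)%N -> alt_chain T n z ->
  (forall q, tcycle (z q)) -> tuple_bd z = 0 ->
  exists v, [/\ alt_chain T n.+1 v, forall q, tcycle (v q) & z = tuple_bd v].
Proof.
move: {-1}(r - k)%N (erefl (r - k)%N) => d; elim: d k n z => [|d IHd] k n z dk kr rn zr zC dz.
  (* In row [r] the preimage [w] lies in row [r.+1], which is zero, so [z] is zero. *)
  have ek : k = r by apply/eqP; rewrite eqn_leq kr -subn_eq0 dk.
  subst k; have [w wr wz] := alt_chain_cone zr zC.
  exists 0; split; [exact: alt_chain0| | ].
    by move=> q; rewrite ffunE; case: (r) => //= k; rewrite linear0.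
  rewrite -wz (alt_chain_eq0 wr) [RHS](bd0 _); apply/ffunP => q.
  by rewrite !ffunE linear0.
have ltkr : (k < r)%N by rewrite -subn_gt0 dk.
case: n => [|n] in rn zr *.
  have := leq_trans ltkr (leq_trans (leq_addl (r * L) r) rn).
  by rewrite add0n ltnn.
have [w wr wz] := alt_chain_cone zr zC.
have yr : alt_chain T n (tuple_bd w) by apply: alt_chain_bd.
have tail0 (x : tuple_chain k.+1) : tail_chain x = 0 -> forall q, tcycle (x q).
  by move=> x0 q; move/ffunP/(_ q): x0; rewrite !ffunE.
have [|||q||v [vr vC yv]] := IHd k.+1 n (tuple_bd w) _ _ _ yr.
- by rewrite subnS dk.
- by [].
- by rewrite addnS -addSn.
- by apply: tail0; rewrite -tuple_bd_tail wz.
- exact: tuple_bd_bd.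
(* From [r * L + r <= n.+1 + k] and [k.+1 <= r] one gets [r * L <= n]. *)
have Ln : (k.+1 * L < n.+1)%N.
  rewrite ltnS; have kL : (k.+1 * L <= r * L)%N by rewrite leq_mul2r ltkr orbT.
  apply: leq_trans kL _; rewrite -(leq_add2r k.+1) [leqRHS]addnS -addSn.
  by apply: leq_trans rn; rewrite leq_add2l.
have [|u ur wu] := alt_chain_exact (tuples_leray hL) Ln (alt_chainB wr vr).
  by rewrite tuple_bdB yv subrr.
(* Taking tails in [w - v = tuple_bd u] gives [z], as [v] has zero tail. *)
exists (tail_chain u); split.
- exact: alt_chain_tail.
- case: (k) u ur {wu} => //= k' u [_ _ _ uA] q; rewrite ffunE; exact: tail_tail0.
rewrite tuple_bd_tail -wu tail_chainB wz [X in _ - X](_ : _ = 0) ?subr0 //.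
by apply/ffunP => q; rewrite ffunE [RHS]ffunE; apply: (vC q).
Qed.
End Descent.

(** * Fibres of the map on realizations *)

Section Fibres.
Variables (W : finType) (m : nat) (c : W -> 'I_m) (X : {set {set W}}).
Hypothesis hcol : forall s, s \in X -> {in s &, injective c}.

(** The weight depends only on the image of [s], so lifts of one [q] visibly share it; it is the
    inverse of [#|s|] when [c] is injective on [s]. *)
Definition barycenter (s : {set W}) : {ffun W -> Rdefinitions.R} :=
  [ffun v => if v \in s then (#|c @: s|%:R)^-1 else 0].

(** The barycentres of the lifts of [q] are distinct points of one fibre. *)
Lemma card_lifts r q : is_r c X r -> (#|lifts c X q| <= r)%N.
Proof.
move=> [[x [xX [l [_ sl fl]]]] fr].
have r0 : (0 < r)%N by rewrite -sl; case: (l) (fl x) => // -[/(_ (conj xX erefl))].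
have liftsP s : s \in lifts c X q -> [/\ s \in X, c @: s = q & {in s &, injective c}].
  by rewrite inE => /andP[sX /eqP]; split=> //; apply: hcol.
(* The empty simplex, the only possible lift of [set0], has no barycentre; here [0 < r] suffices,
   since a fibre of size [r] contains its base point. *)
have [q0|q0] := eqVneq q set0.
  apply: leq_trans r0; rewrite -(cards1 (set0 : {set W})); apply/subset_leq_card/subsetP => s.
  by case/liftsP => _ sq _; rewrite inE -(imset_eq0 c) sq q0.
have [->|[s0 s0q]] := set_0Vmem (lifts c X q); first by rewrite cards0.
have qn0 : #|q|%:R != 0 :> Rdefinitions.R by rewrite pnatr_eq0 cards_eq0.
have supp_bary s : s \in lifts c X q -> [set v | barycenter s v != 0] = s.
  case/liftsP => _ sq _; apply/setP => v; rewrite inE ffunE sq.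
  by case: ifP => _; rewrite ?invr_eq0 ?qn0 // eqxx.
have bary_in s : s \in lifts c X q -> in_realization X (barycenter s).
  move=> sl'; have [sX sq cinj] := liftsP s sl'; split=> [v|].
    by rewrite ffunE; case: ifP => // _; rewrite invr_ge0 ler0n.
  split; last by rewrite supp_bary.
  under eq_bigr do rewrite ffunE.
  rewrite -big_mkcond /= sumr_const -(card_in_imset cinj) sq.
  by rewrite -[_ *+ _]mulr_natr mulVf.
have pi_bary s : s \in lifts c X q ->
    pi_real c (barycenter s) = [ffun i => \sum_(j in q) if j == i then (#|q|%:R)^-1 else 0].
  case/liftsP => _ sq cinj; apply/ffunP => i; rewrite !ffunE -[in RHS]sq big_imset //=.
  rewrite big_mkcond [RHS]big_mkcond; apply: eq_bigr => v _; rewrite ffunE sq.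
  by do 2!case: ifP.
rewrite cardE -(size_map barycenter); apply: (fr (barycenter s0)); first exact: bary_in.
  rewrite map_inj_in_uniq ?enum_uniq // => s t; rewrite !mem_enum => sl' tl' st.
  by rewrite -(supp_bary s) // st supp_bary.
move=> y /mapP[s]; rewrite mem_enum => sl' ->; split; first exact: bary_in.
by rewrite !pi_bary.
Qed.
End Fibres.

(** * The Leray number of the image complex *)

Lemma tuple_bd0E (W I : finType) (c : W -> I) (X : {set {set W}}) (hX : is_complex X)
    (v : {ffun {set I} -> {ffun {ffun 'I_0 -> {set W}} -> rat^o}}) q e :
  tuple_bd c hX v q e = simplicial_bd [ffun q => v q e] q.
Proof.
rewrite tuple_bdE simplicial_bdE sum_ffunE; apply: eq_bigr => i _; rewrite !ffunE (big_pred1 e) // => x.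
by apply/eqP/eqP => _; apply/ffunP => -[].
Qed.

(** Chains of the image complex induced on [S] are the alternating chains of row [0], so the descent
    from [k = 0] applies in size [i.+1]. *)
Lemma image_leray (W : finType) (m : nat) (c : W -> 'I_m) (X : {set {set W}}) (r L : nat) :
  is_complex X -> (forall s, s \in X -> {in s &, injective c}) ->
  (forall q, #|lifts c X q| <= r)%N -> leray_bound X L ->
  leray_bound (image_complex c X) (r * L + r - 1).
Proof.
move=> hX hcol hr hL S i hi.
have hA : tleray (liftmod c hX) (unit_cset _) L.
  apply: liftmod_leray => // T [//|n] Ln.
  by apply/rhom_vanishP/hL; rewrite -ltnS.
have voidP q : lifts c X q = set0 <-> q \notin image_complex c X.
  split=> [q0|qY]; first apply/imsetP => -[s sX qE].
    by move/setP/(_ s): q0; rewrite !inE sX qE eqxx.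
  apply/setP => s; rewrite !inE; apply/negP => /andP[sX /eqP sq].
  by move/negP: qY; apply; rewrite -sq; apply: imset_f.
apply/rhom_vanishP => z zT zK dz.
have z0 q : q \notin induced (image_complex c X) S -> z q = 0.
  by move=> /negPf qK; have := zK q; rewrite /in_complex qK => /eqP.
pose Z : {ffun {set 'I_m} -> {ffun {ffun 'I_0 -> {set W}} -> rat^o}} :=
  [ffun q => [ffun=> z q]].
have flatZ e : [ffun q => Z q e] = z by apply/ffunP => q; rewrite !ffunE.
have Zr : alt_chain c hX S i.+1 Z.
  split.
  - move=> q qS; apply/ffunP => e; rewrite !ffunE.
    have [/setIdP[_ qS']|/z0 //] := boolP (q \in induced (image_complex c X) S).
    by apply: zT; move: qS; rewrite qS' subsetT.
  - by move=> q e /forallP[] -[].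
  - move=> q /voidP qY; apply/ffunP => e; rewrite !ffunE z0 //.
    by rewrite inE (negPf qY).
  - move=> q p e; rewrite !ffunE (_ : p = 1%g) ?odd_perm1 ?expr0 ?mul1r //.
    by apply/permP => -[].
have [||v [[vT vF vV vA] _ Zv]] := alt_chain_descent hr hA (leq0n r) _ Zr (fun=> Logic.I).
- by rewrite addn0 -add1n -leq_subLR.
- apply/ffunP => q; apply/ffunP => e; rewrite tuple_bd0E flatZ [RHS](_ : _ = 0); last by rewrite !ffunE.
  exact: dz.
pose e0 : {ffun 'I_0 -> {set W}} := [ffun=> set0].
exists [ffun q => v q e0]; split.
- move=> q qT; rewrite ffunE vT ?ffunE //; apply: contra qT => /andP[_ ->].
  by rewrite subsetT.
- move=> q; rewrite /in_complex inE ffunE.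
  have [qY|/voidP qY] := boolP (q \in image_complex c X); last by rewrite vV // ffunE eqxx orbT.
  have [//|qS] := boolP (q \subset S); by rewrite vT ?ffunE ?eqxx // (negPf qS).
move=> q; rewrite -[bd _ _]/(simplicial_bd _) -(tuple_bd0E c hX) -Zv !ffunE; exact: subrr.
Qed.

Local Close Scope ring_scope.

Theorem theorem1p2 (m : nat) (W : finType) (c : W -> 'I_m)
    (X : {set {set W}})
    (hX : is_complex X)
    (hcol : forall s, s \in X -> colorful c s)
    (r LX LY : nat)
    (hr : is_r c X r)
    (hLX : is_leray_number X LX)
    (hLY : is_leray_number (image_complex c X) LY) :
  (LY <= r * LX + r - 1)%N.
Proof.
have cinj s : s \in X -> {in s &, injective c} by move=> /hcol sc u v; apply: sc.
apply: hLY.2; apply: image_leray => //; last exact: hLX.1.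
by move=> q; apply: card_lifts.
Qed.
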